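(* Let $X=\{X_t;\ t\in\mathbf{R}_+\}$ be a multifractional Brownian motion with parameter function $H:\mathbf{R}_+\to(0,1)$. For any fixed $t_0$, the $2$-microlocal frontier of $X$ at $t_0$ in the region $$D=\{(s',\sigma):\ -1<s'<0,\ 0<\sigma<1+s'\}$$ is almost surely equal to the minimum of the $2$-microlocal frontier of $H$ at $t_0$ and the line $\sigma=H(t_0)+s'$. More precisely, for all $t_0$, in the region $D$, $$\boldsymbol{\sigma}_{t_0}(s')=(H(t_0)+s')\wedge\beta_{t_0}(s')\quad\text{with probability one,}$$ where $\beta_{t_0}(s')$ denotes the $2$-microlocal frontier of the deterministic function $H$ at $t_0$.
   Context: Multifractional Brownian motion (mBm) with function $H$ is the Gaussian process $$X_t=\int_{\mathbf{R}}\left[|t-u|^{H(t)-\frac12}-|u|^{H(t)-\frac12}\right]\mathbb{W}(du),$$ where $\mathbb{W}$ is the white noise of $\mathbf{R}$. The paper takes as known about mBm that it is Hölder-continuous but not differentiable and that its incremental variance satisfies: for each $t_0$ there are positive constants $K(t_0),L(t_0)$ such that, for $t,u\in B(t_0,\rho)$, $$E[(X_t-X_u)^2]=K(t_0)|t-u|^{2H(t)}+L(t_0)[H(t)-H(u)]^2+o\big(|t-u|^{2H(t)}\big)+o\big((H(t)-H(u))^2\big).$$ $B(t_0,\rho)$ is the ball of centre $t_0$ and radius $\rho$ in $\mathbf{R}_+=[0,\infty)$. For $s'\in(-\infty,0)$, $$\boldsymbol{\sigma}_{t_0}(s')=\sup\Big\{\sigma:\limsup_{\rho\to0}\sup_{t\ne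 u\in B(t_0,\rho)}\frac{|X_t-X_u|}{|t-u|^{\sigma}\rho^{-s'}}<\infty\Big\},\qquad \beta_{t_0}(s')=\sup\Big\{\beta:\limsup_{\rho\to0}\sup_{t\ne u\in B(t_0,\rho)}\frac{|H(t)-H(u)|}{|t-u|^{\beta}\rho^{-s'}}<\infty\Big\}.$$ Equality ''in the region $D$'' means that the parts of the two graphs lying in $D$ coincide. $\wedge$ denotes minimum. *)

(* Defs.v *)
From HB Require Import structures.
From mathcomp Require Import all_boot all_order all_algebra.
From mathcomp Require Import all_classical all_reals all_analysis.
Set Implicit Arguments.
Unset Strict Implicit.
Unset Printing Implicit Defensive.
Import Order.TTheory GRing.Theory Num.Theory.
Import numFieldNormedType.Exports.
Import HBSimple.
Local Open Scope classical_set_scope.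
Local Open Scope ring_scope.

Section WhiteNoise.
Context {R : realType} {d : measure_display} {T : measurableType d}.
Variable P : probability T R.

(* [normal_prob 0 0] is the uniform law on [0, 1] in the library, so the
   degenerate Gaussian law is given separately as a Dirac mass. *)
Definition centered_gaussian (Y : T -> R) : Prop :=
  exists s : R, forall B : set R, measurable B ->
    P (Y @^-1` B) = if s == 0 then \d_(0 : R) B else normal_prob 0 s B.

Definition finite_borel (A : set R) : Prop :=
  measurable A /\ (lebesgue_measure A < +oo)%E.

(* The values of [W] outside [finite_borel] are irrelevant. *)
Definition white_noise (W : set R -> {RV P >-> R}) : Prop :=
  (forall (n : nat) (c : 'I_n -> R) (A : 'I_n -> set R),
     (forall i, finite_borel (A i)) ->
     centered_gaussian (fun w => \sum_(i < n) c i * W (A i) w)) /\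
  (forall A B : set R, finite_borel A -> finite_borel B ->
     ('E_P[fun w => (W A w * W B w)%R] = lebesgue_measure (A `&` B))%E).

(* Integral of a square-integrable simple function: for x != 0 the set
   [g @^-1` [set x]] has finite Lebesgue measure, and the term x = 0 vanishes.
   Only finitely many terms are nonzero, as for the library's [sintegral]. *)
Definition simple_wiener_integral (W : set R -> {RV P >-> R})
    (g : {sfun R >-> R}) (w : T) : R :=
  \sum_(x \in range g) x * W (g @^-1` [set x]) w.

(* [Y] is a version of the integral of [f] against [W], obtained as the L^2
   extension of the integral of simple functions. *)
Definition wiener_integral (W : set R -> {RV P >-> R}) (f : R -> R)
    (Y : {RV P >-> R}) : Prop :=
  exists g : nat -> {sfun R >-> R},
    [/\ forall n, (\int[lebesgue_measure]_u ((g n u) ^+ 2)%:E < +oo)%E,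
        (\int[lebesgue_measure]_u ((f u - g n u) ^+ 2)%:E)%E
          @[n --> \oo] --> 0%E &
        ('E_P[fun w => ((Y w - simple_wiener_integral W (g n) w) ^+ 2)%R])%E
          @[n --> \oo] --> 0%E].

End WhiteNoise.

(* Functions and processes indexed by R_+ are represented by total functions of
   a real parameter, whose values at negative parameters are never used. *)

(* [powR] sends 0 to 0 for a nonzero exponent; this only affects the Lebesgue-null
   set of u with u = t or u = 0. *)
Definition mbm_kernel {R : realType} (H : R -> R) (t u : R) : R :=
  `|t - u| `^ (H t - 2^-1) - `|u| `^ (H t - 2^-1).

Definition mbm {R : realType} {d : measure_display} {T : measurableType d}
    (P : probability T R) (H : R -> R) (X : R -> {RV P >-> R}) : Prop :=
  exists W : set R -> {RV P >-> R}, white_noise W /\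
    forall t, 0 <= t -> wiener_integral W (mbm_kernel H t) (X t).

(* The remainders are o(.) as (t, u) tends to (t0, t0) inside R_+ x R_+, with
   t = p.1 and u = p.2. *)
Definition increment_variance {R : realType} {d : measure_display}
    {T : measurableType d} (P : probability T R) (H : R -> R)
    (X : R -> {RV P >-> R}) (t0 : R) : Prop :=
  let F := within [set p : R * R | 0 <= p.1 /\ 0 <= p.2] (nbhs (t0, t0)) in
  let dt := fun p : R * R => `|p.1 - p.2| `^ (2 * H p.1) in
  let dH := fun p : R * R => (H p.1 - H p.2) ^+ 2 in
  exists K L : R, exists r1 r2 : R * R -> R,
    [/\ 0 < K, 0 < L, r1 =o_F dt, r2 =o_F dH &
        \forall p \near F,
          ('E_P[fun w => ((X p.1 w - X p.2 w) ^+ 2)%R]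
             = (K * dt p + L * dH p + r1 p + r2 p)%:E)%E].

Section Frontier.
Context {R : realType}.

Definition Rplus_ball (t0 rho : R) : set R :=
  [set t | 0 <= t /\ `|t - t0| < rho].

Definition local_oscillation (f : R -> R) (t0 s' sigma rho : R) : \bar R :=
  ereal_sup [set z : \bar R | exists t u : R,
    [/\ Rplus_ball t0 rho t, Rplus_ball t0 rho u, t != u &
        z = (`|f t - f u| / (`|t - u| `^ sigma * rho `^ (- s')))%:E]].

Definition microlocal_frontier (f : R -> R) (t0 s' : R) : \bar R :=
  ereal_sup [set sigma%:E | sigma in [set sigma : R |
    (limf_esup (local_oscillation f t0 s' sigma) (0 : R)^'+ < +oo)%E]].

Definition region_D : set (R * R) :=
  [set p | -1 < p.1 < 0 /\ 0 < p.2 < 1 + p.1].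

Definition graph_in (D : set (R * R)) (phi : R -> \bar R) : set (R * R) :=
  [set p | D p /\ phi p.1 = (p.2)%:E].

End Frontier.

(* Main.v *)
(* The increment X_t - X_u is an L^2 limit of centered Gaussian variables, so its
   law has Gaussian tails and bounded density at the scale of its standard
   deviation, and near t0 its variance v(t, u) is comparable with
   |t - u|^(2 H(t)) + (H(t) - H(u))^2.

   Upper bound: if the oscillation of X of order (s, sigma) is bounded with positive
   probability, then bounded density forces v(t, u) <= C |t - u|^(2 sigma) rho^(-2 s)
   on small balls. The second term of v gives the same regularity for H, and the
   first one, taken at t = t0 and |t - u| = rho / 2, gives sigma <= H(t0) + s.

   Lower bound: for 0 < sigma < sigma1 < H(t0) + s, regularity of order (s, sigma1)
   for H bounds v(t, u) by C |t - u|^(2 sigma1) rho^(-2 s); the Gaussian tails and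
   Borel-Cantelli control all the dyadic increments around t0 of a fine enough
   level, and chaining with path continuity gives regularity of order (s, sigma).

   The region of admissible (s, sigma) is monotone, and its boundary is 1-Lipschitz
   in s, so countably many rational pairs determine the frontier. *)

Require Import Defs.
From HB Require Import structures.
From mathcomp Require Import all_boot all_order all_algebra.
From mathcomp Require Import all_classical all_reals all_analysis.
From mathcomp Require Import measurable_realfun.
From mathcomp Require Import ring lra zify.
Import Order.TTheory GRing.Theory Num.Theory.
Import numFieldNormedType.Exports.
Import HBSimple.
Local Open Scope classical_set_scope.
Local Open Scope ring_scope.

(** * Gaussian laws *)

Lemma measurable_norm_ge {R : realType} {d : measure_display} {T : measurableType d}
    (a : R) (f : T -> R) : measurable_fun setT f -> measurable [set w | a <= `|f w|].
Proof.
move=> mf; have -> : [set w | a <= `|f w|] = (Num.norm \o f) @^-1` `[a, +oo[.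
  by apply/seteqP; split => x /=; rewrite in_itv/= andbT.
by rewrite -[X in measurable X]setTI; apply: (measurableT_comp _ mf).
Qed.

Lemma measurable_norm_le {R : realType} {d : measure_display} {T : measurableType d}
    (a : R) (f : T -> R) : measurable_fun setT f -> measurable [set w | `|f w| <= a].
Proof.
move=> mf; have -> : [set w | `|f w| <= a] = (Num.norm \o f) @^-1` `]-oo, a].
  by apply/seteqP; split => x /=; rewrite in_itv.
by rewrite -[X in measurable X]setTI; apply: (measurableT_comp _ mf).
Qed.

(* For |x| >= a the density of standard deviation s is at most
   2 exp(- a^2 / (4 s^2)) times the density of standard deviation 2 s. *)
Lemma normal_prob_tail {R : realType} (s a : R) : s != 0 -> 0 <= a ->
  (normal_prob 0 s [set x : R | (a <= `|x|)%R]
    <= (2 * expR (- (a ^+ 2 / (4 * s ^+ 2))))%:E)%E.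
Proof.
move=> s0 a0; have s20 : 0 < s ^+ 2 by rewrite exprn_even_gt0.
set c := 2 * expR _.
have ms : measurable [set x : R | a <= `|x|].
  exact: (@measurable_norm_ge R _ (measurableTypeR R) a id (@measurable_id _ _ _)).
(* Doubling the deviation halves the peak of the density, hence the factor 2 in the bound. *)
have peakE : normal_peak s = 2 * normal_peak (2 * s).
  rewrite /normal_peak (_ : (2 * s) ^+ 2 * pi *+ 2 = 2 ^+ 2 * (s ^+ 2 * pi *+ 2)); last by ring.
  by rewrite sqrtrM ?sqr_ge0// sqrtr_sqr ger0_norm// invfM mulrA divff// mul1r.
have c0 : 0 <= c by rewrite mulr_ge0 ?expR_ge0.
apply: (@le_trans _ _ (\int[lebesgue_measure]_(x in [set x : R | (a <= `|x|)%R])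
    (c%:E * (normal_pdf 0 (2 * s) x)%:E))%E).
  apply: ge0_le_integral => //=.
  - by move=> x _; rewrite lee_fin normal_pdf_ge0.
  - by apply/measurable_funTS/measurable_EFinP; exact: measurable_normal_pdf.
  - apply/measurable_funTS/measurable_EFinP/measurable_funM => //.
    exact: measurable_normal_pdf.
  move=> x ax; rewrite -EFinM lee_fin.
  have ? : 2 * s != 0 by rewrite mulf_neq0.
  rewrite !normal_pdfE// peakE /c [X in _ <= X](_ : _ =
    2 * normal_peak (2 * s) * (expR (- (a ^+ 2 / (4 * s ^+ 2))) * normal_fun 0 (2 * s) x)); last by ring.
  rewrite ler_pM2l ?mulr_gt0 ?normal_peak_gt0// /normal_fun -expRD ler_expR !subr0.
  have xa : a ^+ 2 <= x ^+ 2 by rewrite -(real_normK (num_real x)) lerXn2r ?nnegrE.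
  have s2 : 0 <= (s ^+ 2)^-1 by rewrite invr_ge0 sqr_ge0.
  have -> : - x ^+ 2 / (s ^+ 2 *+ 2) = - (x ^+ 2 * (s ^+ 2)^-1 / 2) by field.
  have -> : - (a ^+ 2 / (4 * s ^+ 2)) = - (a ^+ 2 * (s ^+ 2)^-1 / 4) by field.
  have -> : - x ^+ 2 / ((2 * s) ^+ 2 *+ 2) = - (x ^+ 2 * (s ^+ 2)^-1 / 8) by field.
  have := ler_wpM2r s2 xa; have : 0 <= x ^+ 2 * (s ^+ 2)^-1 by rewrite mulr_ge0 ?sqr_ge0.
  set u := x ^+ 2 * _; set v := a ^+ 2 * _; lra.
rewrite ge0_integralZl_EFin//; last 2 first.
- by move=> x _; rewrite lee_fin normal_pdf_ge0.
- by apply/measurable_funTS/measurable_EFinP; exact: measurable_normal_pdf.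
rewrite -[leRHS]mule1 lee_wpmul2l// -(integral_normal_pdf 0 (2 * s)).
apply: ge0_subset_integral => //.
- by apply/measurable_EFinP; exact: measurable_normal_pdf.
- by move=> x _; rewrite lee_fin normal_pdf_ge0.
Qed.

(** The density is at most its peak 1 / sqrt (2 pi s^2), which is below 1 / |s| because 2 pi >= 1,
    and the interval has length [2 * a]. *)
Lemma normal_prob_small {R : realType} (s a : R) : s != 0 -> 0 <= a ->
  (normal_prob 0 s [set x : R | (`|x| <= a)%R] <= (2 * a / `|s|)%:E)%E.
Proof.
move=> s0 a0; pose I : set (measurableTypeR R) := `[- a, a]%classic.
have mI : measurable I by exact: measurable_itv.
have -> : [set x : R | `|x| <= a] = I.
  by apply/seteqP; split => x /=; rewrite /I /= in_itv/= ler_norml.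
apply: (@le_trans _ _ (\int[lebesgue_measure]_(x in I) (`|s|^-1)%:E)%E).
  apply: ge0_le_integral => //=.
  - by move=> x _; rewrite lee_fin normal_pdf_ge0.
  - by apply/measurable_funTS/measurable_EFinP; exact: measurable_normal_pdf.
  move=> x _; rewrite lee_fin (le_trans (normal_pdf_ub _ _ s0))// /normal_peak.
  have p0 : 0 < s ^+ 2 * pi *+ 2.
    by rewrite pmulrn_lgt0// mulr_gt0 ?pi_gt0// exprn_even_gt0.
  rewrite lef_pV2 ?posrE ?normr_gt0 ?sqrtr_gt0// -sqrtr_sqr ler_sqrt ?(ltW p0)//.
  by have := @pi_ge2 R; have := sqr_ge0 s; rewrite -mulr_natr => ? ?; nra.
rewrite integral_cst//= /I lebesgue_measure_itv/= lte_fin.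
case: ifPn => _; last by rewrite mule0 lee_fin divr_ge0// mulr_ge0.
by rewrite -EFinB -EFinM lee_fin le_eqVlt; apply/orP; left; apply/eqP; ring.
Qed.

Section GaussianLaw.
Context {R : realType} {d : measure_display} {T : measurableType d}.
Variable P : probability T R.
Local Open Scope ereal_scope.

(** The body of [centered_gaussian] with its deviation exposed, since [s ^+ 2] has to be compared
    with second moments. The sign of [s] is free. *)
Definition gaussian_law (Z : T -> R) (s : R) := forall B : set R, measurable B ->
  P (Z @^-1` B) = if s == 0%R then \d_(0%R : R) B else normal_prob 0 s B.

Lemma gaussian_tail (Z : {RV P >-> R}) (s t a : R) : gaussian_law Z s ->
  (0 < t)%R -> (s ^+ 2 <= t)%R -> (0 <= a)%R ->
  P [set w | (a <= `|Z w|)%R] <= (2 * expR (- (a ^+ 2 / (4 * t))))%:E.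
Proof.
(* At [a = 0] the event has probability one, even under the Dirac law, and the claimed bound is
   2. *)
move=> Zs t0 st; rewrite le_eqVlt => /orP[/eqP<-|a0].
  rewrite expr0n/= mul0r oppr0 expR0 mulr1.
  apply: (@le_trans _ _ 1); last by rewrite lee_fin ler1n.
  by rewrite probability_le1//; exact: measurable_norm_ge.
have ms : measurable [set x : measurableTypeR R | (a <= `|x|)%R].
  exact: (@measurable_norm_ge R _ (measurableTypeR R) a id (@measurable_id _ _ _)).
have -> : [set w | (a <= `|Z w|)%R] = Z @^-1` [set x | (a <= `|x|)%R] by [].
rewrite Zs//; case: ifPn => [_|s0].
  rewrite diracE memNset; first by rewrite lee_fin mulr_ge0 ?expR_ge0.
  by move=> /=; rewrite normr0 leNgt a0.
rewrite (le_trans (normal_prob_tail _ _ s0 (ltW a0)))// lee_fin ler_pM2l// ler_expR.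
have s20 : (0 < s ^+ 2)%R by rewrite exprn_even_gt0.
rewrite lerN2 ler_wpM2l ?sqr_ge0// lef_pV2 ?posrE ?(mulr_gt0 _ s20) ?(mulr_gt0 _ t0)//.
by rewrite ler_pM2l.
Qed.

Lemma gaussian_small (Z : T -> R) (s a : R) : gaussian_law Z s -> s != 0%R ->
  (0 <= a)%R -> P [set w | (`|Z w| <= a)%R] <= (2 * a / `|s|)%:E.
Proof.
move=> Zs s0 a0.
have ms : measurable [set x : measurableTypeR R | (`|x| <= a)%R].
  exact: (@measurable_norm_le R _ (measurableTypeR R) a id (@measurable_id _ _ _)).
have -> : [set w | (`|Z w| <= a)%R] = Z @^-1` [set x | (`|x| <= a)%R] by [].
by rewrite Zs// (negbTE s0); exact: normal_prob_small.
Qed.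

Lemma markov_sqr (Y : {RV P >-> R}) (a : R) : (0 < a)%R ->
  P [set w | (a <= `|Y w|)%R] <= (a ^- 2)%:E * 'E_P[fun w => (Y w ^+ 2)%R].
Proof.
move=> a0; rewrite -lee_pdivrMl ?invr_gt0 ?exprn_gt0// invrK.
have := @markov _ _ _ P Y (fun x => x ^+ 2)%R a a0.
rewrite (_ : [set x | _] = [set w | (a <= `|Y w|)%R])//.
rewrite (_ : (_ \o Y)%FUN = fun w => (Y w ^+ 2)%R); last first.
  by apply/funext => w /=; rewrite real_normK// num_real.
apply => //.
- by move=> r _; exact: sqr_ge0.
by move=> x y; rewrite !nnegrE => x0 y0; rewrite ler_sqr.
Qed.

(* Layer cake formula: the tail of Z^2 is dominated by an exponential law. *)
Lemma gaussian_sqr_expectation_le (Z : {RV P >-> R}) (s t : R) :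
  gaussian_law Z s -> (0 < t)%R -> (s ^+ 2 <= t)%R ->
  'E_P[fun w => (Z w ^+ 2)%R] <= (8 * t)%:E.
Proof.
move=> Zs t0 st; pose Z2 : {RV P >-> R} := (Z ^+ 2)%R.
have Z2E w : Z2 w = (Z w ^+ 2)%R by rewrite /Z2 /= expr2.
have -> : (fun w => (Z w ^+ 2)%R) = Z2 by apply/funext => w; rewrite Z2E.
rewrite ge0_expectation_ccdf; last by move=> w; rewrite Z2E sqr_ge0.
(* With this rate, the bound 2 exp(- r / (4 t)) on the tail of Z^2 is exactly [8 * t] times the
   exponential density. *)
pose rate := ((4 * t)^-1)%R.
have rate0 : (0 < rate)%R by rewrite invr_gt0 mulr_gt0.
have pdf0 r : 0 <= (exponential_pdf rate r)%:E.
  by rewrite lee_fin exponential_pdf_ge0// ltW.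
have mpdf : measurable_fun setT (fun r => (exponential_pdf rate r)%:E).
  by apply/measurable_EFinP; exact: measurable_exponential_pdf.
have t80 : (0 <= 8 * t)%R by rewrite mulr_ge0// ltW.
apply: (@le_trans _ _ (\int[lebesgue_measure]_(r in `[0%R, +oo[)
    ((8 * t)%:E * (exponential_pdf rate r)%:E))).
  apply: ge0_le_integral => //.
  - exact: (measurable_funTS (ccdf_measurable _)).
  - apply/measurable_funTS/measurable_EFinP/measurable_funM => //.
    exact: measurable_exponential_pdf.
  move=> r /=; rewrite in_itv/= andbT => r0.
  rewrite exponential_pdfE ?(ltW r0)//.
  apply: (@le_trans _ _ (P [set w | (Num.sqrt r <= `|Z w|)%R])).
    rewrite /ccdf /distribution /pushforward; apply: le_measure.
    - by rewrite inE -[X in measurable X]setTI; exact: measurable_funP.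
    - by rewrite inE; exact: measurable_norm_ge.
    - move=> w rZ; have {rZ} : (r < Z2 w)%R by move: rZ; rewrite /= in_itv/= andbT.
      rewrite Z2E => rZ /=; by rewrite -sqrtr_sqr ler_wsqrtr// ltW.
  rewrite (le_trans (gaussian_tail _ _ _ _ Zs t0 st (sqrtr_ge0 r)))//.
  rewrite sqr_sqrtr// -EFinM lee_fin mulrA (_ : 8 * t * rate = 2)%R; last first.
    by rewrite /rate; field; rewrite gt_eqF.
  by rewrite mulNr (mulrC rate).
rewrite ge0_integralZl_EFin//; last exact: measurable_funTS.
rewrite -[leRHS]mule1 lee_wpmul2l// -(integral_exponential_pdf rate0).
by apply: ge0_subset_integral => //; rewrite -(ltW rate0).
Qed.

(* Half of the mass lies outside the ball of radius |s| / 4, by [gaussian_small]. *)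
Lemma gaussian_sqr_expectation_ge (Z : {RV P >-> R}) (s : R) :
  gaussian_law Z s -> (s ^+ 2)%:E <= 32%:E * 'E_P[fun w => (Z w ^+ 2)%R].
Proof.
move=> Zs; have [->|s0] := eqVneq s 0%R.
  rewrite expr0n/= mule_ge0// expectation_ge0// => w; exact: sqr_ge0.
have s40 : (0 < `|s| / 4)%R by rewrite divr_gt0// normr_gt0.
have := gaussian_small _ _ _ Zs s0 (ltW s40).
have -> : (2 * (`|s| / 4) / `|s| = 1 / 2)%R by field; rewrite normr_eq0.
move=> Psmall.
have Pbig : (1 / 2)%:E <= P [set w | (`|s| / 4 <= `|Z w|)%R].
  have : 1 <= P [set w | (`|Z w| <= `|s| / 4)%R] + P [set w | (`|s| / 4 <= `|Z w|)%R].
    rewrite -(probability_setT P) (le_trans _ (measureU2 _ _ _))//.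
    + apply: le_measure; rewrite ?inE//.
        by apply: measurableU; [exact: measurable_norm_le|exact: measurable_norm_ge].
      by move=> w _ /=; have [|/ltW] := leP (`|Z w|)%R (`|s| / 4)%R; [left|right].
    + exact: measurable_norm_le.
    + exact: measurable_norm_ge.
  move=> /le_trans/(_ (leeD2r _ Psmall)); rewrite -leeBlDl//.
  by apply: le_trans; rewrite -EFinB lee_fin; lra.
(* Chebyshev's inequality at radius |s| / 4 gives (s^2 / 16) (1 / 2) <= E[Z^2], hence the constant
   32. *)
have := le_trans Pbig (markov_sqr Z _ s40).
rewrite lee_pdivlMl ?exprn_gt0// -EFinM -(@lee_pmul2l _ 32%:E)//.
apply: le_trans; rewrite -!EFinM lee_fin expr_div_n real_normK ?num_real//.
by have := sqr_ge0 s; lra.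
Qed.

(** Rests on (z + v)^2 <= 2 z^2 + 2 v^2. The pointwise hypothesis lets [Y] be a sum or a difference
    of [Z] and [V]. *)
Lemma sqr_expectation_le2 (Y Z V : {RV P >-> R}) :
  (forall w, `|Y w| <= `|Z w| + `|V w|)%R ->
  'E_P[fun w => (Y w ^+ 2)%R] <=
  2%:E * 'E_P[fun w => (Z w ^+ 2)%R] + 2%:E * 'E_P[fun w => (V w ^+ 2)%R].
Proof.
move=> YZV.
have mX (X : {RV P >-> R}) : measurable_fun setT (fun w => ((X w) ^+ 2)%R%:E).
  by apply/measurable_EFinP; exact: measurable_funX.
have X0 (X : {RV P >-> R}) (w : T) : 0 <= ((X w) ^+ 2)%R%:E by rewrite lee_fin sqr_ge0.
rewrite unlock -!ge0_integralZl_EFin// -ge0_integralD//; first last.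
- by apply: measurable_funeM.
- by move=> w _; rewrite mule_ge0.
- by apply: measurable_funeM.
- by move=> w _; rewrite mule_ge0.
apply: ge0_le_integral => //.
- by apply: emeasurable_funD; apply: measurable_funeM.
move=> w _; rewrite -!EFinM -EFinD lee_fin.
have := YZV w; rewrite -(real_normK (num_real (Y w))) -(real_normK (num_real (Z w))).
rewrite -(real_normK (num_real (V w))).
have := normr_ge0 (Y w); have := normr_ge0 (Z w); have := normr_ge0 (V w).
set y := `|Y w|%R; set z := `|Z w|%R; set v := `|V w|%R => v0 z0 y0 yzv.
have : (0 <= (z - v) ^+ 2)%R by exact: sqr_ge0.
have : (y ^+ 2 <= (z + v) ^+ 2)%R by rewrite lerXn2r ?nnegrE// addr_ge0.
by rewrite sqrrB sqrrD => ? ?; lra.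
Qed.

Lemma norm_ge_split (Y Z : {RV P >-> R}) (a : R) :
  P [set w | (a <= `|Y w|)%R] <=
  P [set w | (a / 2 <= `|Z w|)%R] + P [set w | (a / 2 <= `|(Y \- Z) w|)%R].
Proof.
rewrite (le_trans _ (measureU2 _ _ _))//; last 2 first.
  exact: measurable_norm_ge.
  exact: measurable_norm_ge.
apply: le_measure; rewrite ?inE//.
- exact: measurable_norm_ge.
- by apply: measurableU; exact: measurable_norm_ge.
move=> w /= aY; have [|Za] := leP (a / 2)%R (`|Z w|)%R; [by left|right].
have := ler_normD (Y w - Z w)%R (Z w); rewrite subrK; lra.
Qed.

Lemma norm_le_split (Y Z : {RV P >-> R}) (a : R) :
  P [set w | (`|Y w| <= a)%R] <=
  P [set w | (`|Z w| <= 2 * a)%R] + P [set w | (a <= `|(Y \- Z) w|)%R].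
Proof.
rewrite (le_trans _ (measureU2 _ _ _))//; last 2 first.
  exact: measurable_norm_le.
  exact: measurable_norm_ge.
apply: le_measure; rewrite ?inE//.
- exact: measurable_norm_le.
- by apply: measurableU; [exact: measurable_norm_le|exact: measurable_norm_ge].
move=> w /= aY; have [|Za] := leP (`|Z w|)%R (2 * a)%R; [by left|right].
have := ler_normB (Y w) (Y w - Z w)%R; rewrite opprB addrCA subrr addr0; lra.
Qed.

(** The form in which the Gaussian character of the increments is used: tail and small ball bounds
    survive such limits, up to constants. *)
Definition gaussian_limit (Y : {RV P >-> R}) := forall e : R, (0 < e)%R ->
  exists (Z : {RV P >-> R}) (s : R), gaussian_law Z s /\
    'E_P[fun w => ((Y \- Z)%R w ^+ 2)%R] <= e%:E.

(** The approximation [Z] has second moment at most 4 v, so its squared deviation is at most 32 * 4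
    v = 128 v; at the threshold a / 2 the exponent becomes a^2 / (4 * 4 * 128 v). *)
Lemma gaussian_limit_tail (Y : {RV P >-> R}) (v a : R) : gaussian_limit Y ->
  (0 < v)%R -> 'E_P[fun w => (Y w ^+ 2)%R] <= v%:E -> (0 < a)%R ->
  P [set w | (a <= `|Y w|)%R] <= (2 * expR (- (a ^+ 2 / (2048 * v))))%:E.
Proof.
move=> Ylim v0 Yv a0; apply/lee_addgt0Pr => e e0.
have a20 : (0 < a / 2)%R by rewrite divr_gt0.
(* The first term controls the second moment of [Z], the second one makes the Chebyshev error on Y -
   Z at most [e]. *)
pose e1 := Num.min v (e * (a / 2) ^+ 2)%R.
have e10 : (0 < e1)%R by rewrite lt_min v0 mulr_gt0// exprn_gt0.
have [Z [s [Zs YZ]]] := Ylim _ e10.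
have Zv : 'E_P[fun w => (Z w ^+ 2)%R] <= (4 * v)%:E.
  apply: (le_trans (@sqr_expectation_le2 Z Y (Y \- Z)%R _)).
    by move=> w /=; have := ler_normB (Y w) (Y w - Z w)%R; rewrite opprB addrCA subrr addr0.
  apply: (@le_trans _ _ (2%:E * v%:E + 2%:E * v%:E)).
    apply: leeD; apply: lee_wpmul2l => //.
    by rewrite (le_trans YZ)// lee_fin /e1 ge_min lexx.
  by rewrite -!EFinM -EFinD lee_fin; lra.
have sv : (s ^+ 2 <= 128 * v)%R.
  rewrite -lee_fin (le_trans (gaussian_sqr_expectation_ge _ _ Zs))//.
  apply: (@le_trans _ _ (32%:E * (4 * v)%:E)); first by apply: lee_wpmul2l.
  by rewrite -EFinM lee_fin; lra.
apply: (le_trans (norm_ge_split Y Z a)); apply: leeD.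
  have v1280 : (0 < 128 * v)%R by rewrite mulr_gt0.
  rewrite (le_trans (gaussian_tail _ _ _ _ Zs v1280 sv (ltW a20)))//.
  rewrite lee_fin ler_pM2l// ler_expR lerN2 le_eqVlt; apply/orP; left; apply/eqP.
  by field; rewrite gt_eqF.
apply: (le_trans (markov_sqr (Y \- Z)%R _ a20)).
rewrite muleC lee_pdivrMr ?exprn_gt0// (le_trans YZ)//.
by rewrite lee_fin /e1 ge_min lexx orbT.
Qed.

(** The approximation has second moment at least v / 4, whereas s^2 < v / 36 would force it below 8
    v / 36. Hence |s| >= sqrt v / 6, and the small ball bound at radius 2 a is 4 a / |s| <= 24 a /
    sqrt v. *)
Lemma gaussian_limit_small (Y : {RV P >-> R}) (v a : R) : gaussian_limit Y ->
  (0 < v)%R -> v%:E <= 'E_P[fun w => (Y w ^+ 2)%R] -> (0 < a)%R ->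
  P [set w | (`|Y w| <= a)%R] <= (24 * a / Num.sqrt v)%:E.
Proof.
move=> Ylim v0 Yv a0; apply/lee_addgt0Pr => e e0.
pose e1 := Num.min (v / 4)%R (e * a ^+ 2)%R.
have e10 : (0 < e1)%R by rewrite lt_min divr_gt0//= mulr_gt0// exprn_gt0.
have [Z [s [Zs YZ]]] := Ylim _ e10.
have vZ : (v / 4)%:E <= 'E_P[fun w => (Z w ^+ 2)%R].
  have : v%:E <= 2%:E * 'E_P[fun w => (Z w ^+ 2)%R] + (v / 2)%:E.
    apply: (le_trans Yv); apply: (le_trans (@sqr_expectation_le2 Y Z (Y \- Z)%R _)).
      by move=> w /=; have := ler_normD (Z w) (Y w - Z w)%R; rewrite addrCA subrr addr0.
    apply: leeD => //; apply: (@le_trans _ _ (2%:E * e1%:E)); first exact: lee_wpmul2l.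
    have e1v : (e1 <= v / 4)%R by rewrite ge_min lexx.
    by rewrite -EFinM lee_fin; lra.
  rewrite -leeBlDr// -EFinB -lee_pdivrMl//; apply: le_trans.
  by rewrite -EFinM lee_fin; lra.
have sv : (v / 36 <= s ^+ 2)%R.
  rewrite leNgt; apply/negP => sv.
  have v360 : (0 < v / 36)%R by rewrite divr_gt0.
  have := le_trans vZ (gaussian_sqr_expectation_le _ _ _ Zs v360 (ltW sv)).
  by rewrite lee_fin; lra.
have s0 : s != 0%R by apply: contraTneq sv => ->; rewrite expr0n/= -ltNge divr_gt0.
have sv' : (Num.sqrt v / 6 <= `|s|)%R.
  have -> : (Num.sqrt v / 6 = Num.sqrt (v / 36))%R.
    rewrite sqrtrM ?(ltW v0)// (_ : (36 : R) = 6 ^+ 2)%R ?sqrtrV ?sqrtr_sqr ?ger0_norm//.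
    by ring.
  by rewrite -sqrtr_sqr ler_sqrt ?sqr_ge0.
apply: (le_trans (norm_le_split Y Z a)); apply: leeD.
  rewrite (le_trans (gaussian_small _ _ _ Zs s0 _))// ?mulr_ge0 ?(ltW a0)//.
  have sv0 : (0 < Num.sqrt v)%R by rewrite sqrtr_gt0.
  rewrite lee_fin (_ : 24 * a / Num.sqrt v = 2 * (2 * a) / (Num.sqrt v / 6))%R; last first.
    by field; rewrite gt_eqF.
  rewrite ler_pM2l ?mulr_gt0// lef_pV2// posrE ?divr_gt0//.
  by rewrite normr_gt0.
apply: (le_trans (markov_sqr (Y \- Z)%R _ a0)).
rewrite muleC lee_pdivrMr ?exprn_gt0// (le_trans YZ)//.
by rewrite lee_fin /e1 ge_min lexx orbT.
Qed.

End GaussianLaw.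

(** * Increments of multifractional Brownian motion *)

Section WienerGaussian.
Context {R : realType} {d : measure_display} {T : measurableType d}.
Variable P : probability T R.
Variable W : set R -> {RV P >-> R}.
Implicit Type l : seq (R * set R).

Lemma wiener_sum_rv l : exists Z : {RV P >-> R},
  Z = (fun w => \sum_(p <- l) p.1 * W p.2 w) :> (T -> R).
Proof.
elim: l => [|p l [Z Zl]].
  by exists (cst 0 : {RV P >-> R}); apply/funext => w; rewrite big_nil.
exists (cst p.1 * W p.2 + Z)%R; apply/funext => w; rewrite big_cons /=.
by rewrite -[in RHS](congr1 (@^~ w) Zl).
Qed.

Lemma wiener_sum_gaussian l : white_noise W ->
  (forall p, p \in map snd l -> finite_borel p) ->
  centered_gaussian P (fun w => \sum_(p <- l) p.1 * W p.2 w).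
Proof.
move=> [Wg _] fl.
have := Wg (size l) (fun i => (tnth (in_tuple l) i).1) (fun i => (tnth (in_tuple l) i).2).
rewrite (_ : (fun w => \sum_(i < _) _) = fun w => \sum_(p <- l) p.1 * W p.2 w).
  by apply => i; apply: fl; apply/map_f; exact: mem_tnth.
by apply/funext => w; rewrite [RHS](big_tnth _ _ l).
Qed.

(** Chebyshev's inequality: x^2 times the measure of the level set is at most the integral of
    g^2. *)
Lemma sfun_finite_borel (g : {sfun R >-> R}) (x : R) : x != 0 ->
  (\int[lebesgue_measure]_u ((g u) ^+ 2)%:E < +oo)%E ->
  finite_borel (g @^-1` [set x]).
Proof.
move=> x0 gfin.
have mg : measurable (g @^-1` [set x]) by exact: measurable_funPTI.
split => //.
have x20 : 0 < x ^+ 2 by rewrite exprn_even_gt0.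
have : ((x ^+ 2)%:E * lebesgue_measure (g @^-1` [set x]) < +oo)%E.
  apply: le_lt_trans gfin; rewrite -integral_cst//.
  apply: (@le_trans _ _ (\int[lebesgue_measure]_(u in g @^-1` [set x]) ((g u) ^+ 2)%:E)%E).
    rewrite le_eqVlt; apply/orP; left; apply/eqP; apply: eq_integral => u.
    by rewrite inE /= => ->.
  apply: ge0_subset_integral => //.
  - apply/measurable_EFinP/measurable_funX. exact: (@measurable_funPT _ _ _ _ g).
  - by move=> u _; rewrite lee_fin sqr_ge0.
by rewrite !ltey; apply: contra => /eqP ->; rewrite gt0_muley.
Qed.

Lemma simple_wiener_integral_sum (g : {sfun R >-> R}) :
  (\int[lebesgue_measure]_u ((g u) ^+ 2)%:E < +oo)%E ->
  exists l, (forall p, p \in map snd l -> finite_borel p) /\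
    simple_wiener_integral W g = fun w => \sum_(p <- l) p.1 * W p.2 w.
Proof.
move=> gfin.
(* The level set of 0 may have infinite measure; its coefficient is 0, so the empty set can stand
   for it. *)
exists [seq (x, if x == 0 then set0 else g @^-1` [set x]) | x <- finmap.enum_fset (fset_set (range g))].
split.
  move=> A; rewrite -map_comp => /mapP[x _ ->] /=; case: ifPn => x0.
    by split => //; rewrite measure0.
  exact: sfun_finite_borel.
apply/funext => w; rewrite /simple_wiener_integral fsbig_finite//= big_map.
by apply: eq_bigr => x _ /=; case: eqVneq => [->|//]; rewrite !mul0r.
Qed.

Lemma wiener_integral_approx (f : R -> R) (Y : {RV P >-> R}) (e : R) :
  wiener_integral W f Y -> 0 < e ->
  exists l, (forall p, p \in map snd l -> finite_borel p) /\
    ('E_P[fun w => ((Y w - \sum_(p <- l) p.1 * W p.2 w) ^+ 2)%R] <= e%:E)%E.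
Proof.
move=> [g [gfin _ gY]] e0.
have e0' : (0 < e%:E)%E by rewrite lte_fin.
have [n _ /(_ n (leqnn n))/ltW ne] := gY _ (open_ereal_lt' e0').
have [l [fl lE]] := simple_wiener_integral_sum _ (gfin n).
by exists l; split => //; apply: le_trans ne; rewrite lE.
Qed.

(** The approximations of both integrals are merged into one list, with opposite signs on the
    second, so that their difference is a single combination of values of [W] and hence Gaussian. No
    joint law of [Y1] and [Y2] enters. *)
Lemma wiener_integral_sub_gaussian (f1 f2 : R -> R) (Y1 Y2 : {RV P >-> R}) :
  white_noise W -> wiener_integral W f1 Y1 -> wiener_integral W f2 Y2 ->
  gaussian_limit P (Y1 \- Y2)%R.
Proof.
move=> Wn Yf1 Yf2 e e0; have e40 : 0 < e / 4 by rewrite divr_gt0.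
have [l1 [fl1 lY1]] := wiener_integral_approx _ _ _ Yf1 e40.
have [l2 [fl2 lY2]] := wiener_integral_approx _ _ _ Yf2 e40.
have [Z1 Z1E] := wiener_sum_rv l1.
have [Z2 Z2E] := wiener_sum_rv l2.
pose l := l1 ++ [seq (- p.1, p.2) | p <- l2].
have [s Zs] : centered_gaussian P (fun w => \sum_(p <- l) p.1 * W p.2 w).
  apply: wiener_sum_gaussian => // p; rewrite map_cat mem_cat => /orP[/fl1//|].
  by rewrite -map_comp => pl2; exact: fl2.
exists (Z1 \- Z2)%R, s; split.
  move=> B /Zs <-; congr (P (_ @^-1` B)); apply/funext => w /=.
  rewrite Z1E Z2E /l big_cat big_map /= -sumrN; congr (_ + _).
  by apply: eq_bigr => p _; rewrite mulNr.
apply: (le_trans (sqr_expectation_le2 P _ (Y1 \- Z1)%R (Y2 \- Z2)%R _)).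
  move=> w /=; rewrite (_ : _ - _ - _ = Y1 w - Z1 w - (Y2 w - Z2 w)); first exact: ler_normB.
  by rewrite opprB opprB; ring.
apply: (@le_trans _ _ (2%:E * (e / 4)%:E + 2%:E * (e / 4)%:E))%E; last first.
  by rewrite -!EFinM -EFinD lee_fin; lra.
by apply: leeD; apply: lee_wpmul2l => //=; rewrite ?Z1E ?Z2E.
Qed.

End WienerGaussian.

Lemma mbm_increment_gaussian {R : realType} {d : measure_display} {T : measurableType d}
    (P : probability T R) (H : R -> R) (X : R -> {RV P >-> R}) (t u : R) :
  mbm H X -> 0 <= t -> 0 <= u -> gaussian_limit P (X t \- X u)%R.
Proof.
move=> [W [Wn XW]] t0 u0.
exact: (wiener_integral_sub_gaussian _ _ _ _ _ _ Wn (XW t t0) (XW u u0)).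
Qed.

(** * Two-microlocal regularity *)

Section MicrolocalBound.
Context {R : realType}.

(** Free of division, so that pairs with t = u are allowed: for [0 <= C] they satisfy the inequality
    trivially. *)
Definition microlocal_bound (f : R -> R) (t0 s sigma C r : R) := forall rho t u : R,
  0 < rho < r -> Rplus_ball t0 rho t -> Rplus_ball t0 rho u ->
  `|f t - f u| <= C * (`|t - u| `^ sigma * rho `^ (- s)).

Definition microlocal (f : R -> R) (t0 s sigma : R) := exists C r : R,
  [/\ 0 <= C, 0 < r & microlocal_bound f t0 s sigma C r].

(** The upper limit is an infimum of suprema over right neighbourhoods of 0, so it is below [+oo]
    exactly when one of these suprema is, and such a neighbourhood contains some ]0, r[. *)
Lemma microlocalP (f : R -> R) (t0 s sigma : R) :
  (limf_esup (local_oscillation f t0 s sigma) (0 : R)^'+ < +oo)%E <->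
  microlocal f t0 s sigma.
Proof.
split.
- move=> /ereal_inf_lt[_ [V V0 <-]] supV.
  have [C C0 supC] : exists2 C : R, 0 <= C &
      (ereal_sup [set local_oscillation f t0 s sigma rho | rho in V] <= C%:E)%E.
    case: (ereal_sup _) supV => [c _|//|_]; last by exists 0; rewrite ?leNye.
    by exists (Num.max c 0); rewrite ?lee_fin le_max lexx ?orbT.
  have [r r0 rV] : exists2 r : R, 0 < r & forall rho, 0 < rho < r -> V rho.
    move: V0 => -[r /= r0 rV]; exists r => // rho /andP[rho0 rhor].
    by apply: rV => //=; rewrite sub0r normrN gtr0_norm.
  exists C, r; split => // rho t u rho0r tb ub.
  have [->|tu] := eqVneq t u.
    by rewrite !subrr normr0 mulr_ge0// mulr_ge0// powR_ge0.
  have rho0 : 0 < rho by case/andP: rho0r.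
  rewrite -ler_pdivrMr ?mulr_gt0 ?powR_gt0 ?normr_gt0 ?subr_eq0// -lee_fin.
  apply: le_trans supC; apply: (@le_trans _ _ (local_oscillation f t0 s sigma rho)).
    by apply: ereal_sup_ubound; exists t, u.
  by apply: ereal_sup_ubound; exists rho => //; exact: rV.
- move=> [C [r [C0 r0 fC]]].
  apply: (@le_lt_trans _ _ C%:E); last exact: ltry.
  apply: (@le_trans _ _ (ereal_sup [set local_oscillation f t0 s sigma rho | rho in `]0, r[%classic])).
    apply: ereal_inf_lbound; exists `]0, r[%classic => //.
    exists r => //= rho /=; rewrite sub0r normrN in_itv /= => + rho0.
    by rewrite gtr0_norm// rho0.
  apply: ub_ereal_sup => _ [rho + <-]; rewrite /= in_itv /= => rhor.
  apply: ub_ereal_sup => _ [t [u [tb ub tu ->]]].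
  have rho0 : 0 < rho by case/andP: rhor.
  by rewrite lee_fin ler_pdivrMr ?mulr_gt0 ?powR_gt0 ?normr_gt0 ?subr_eq0// fC.
Qed.

Lemma frontier_ge (f : R -> R) (t0 s sigma : R) : microlocal f t0 s sigma ->
  (sigma%:E <= microlocal_frontier f t0 s)%E.
Proof. by move=> /microlocalP fs; apply: ereal_sup_ubound; exists sigma. Qed.

Lemma frontier_gt (f : R -> R) (t0 s sigma : R) : (sigma%:E < microlocal_frontier f t0 s)%E ->
  exists2 sigma', sigma < sigma' & microlocal f t0 s sigma'.
Proof.
by move=> /ereal_sup_gt[_ [sigma' /microlocalP fs <-]]; rewrite lte_fin; exists sigma'.
Qed.

(* The frontier is nondecreasing and 1-Lipschitz in its first argument. *)
Lemma microlocal_le (f : R -> R) (t0 s sigma s' sigma' : R) : microlocal f t0 s sigma ->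
  sigma' <= sigma -> s - (sigma - sigma') <= s' -> microlocal f t0 s' sigma'.
Proof.
move=> [C [r [C0 r0 fC]]] sg ss.
exists (C * 2 `^ (sigma - sigma')), (Num.min r 1); split.
- by rewrite mulr_ge0// powR_ge0.
- by rewrite lt_min r0 ltr01.
move=> rho t u /andP[rho0]; rewrite lt_min => /andP[rhor rho1] tb ub.
have [->|tu] := eqVneq t u.
  by rewrite !subrr normr0 !mulr_ge0// ?powR_ge0.
have tu0 : 0 < `|t - u| by rewrite normr_gt0 subr_eq0.
have tu2 : `|t - u| <= 2 * rho.
  case: tb ub => _ tb [_ ub]; have := ler_distD t0 t u; rewrite (distrC t0); lra.
apply: (le_trans (fC rho t u _ tb ub)); first by rewrite rho0.
rewrite -mulrA ler_wpM2l//.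
(* The surplus |t - u|^(sigma - sigma') is at most (2 rho)^(sigma - sigma'), and rho <= 1 then
   allows the exponent of rho to be lowered to - s'. *)
rewrite [X in `|t - u| `^ X](_ : sigma = sigma' + (sigma - sigma')); last by ring.
rewrite powRD; last by rewrite (gt_eqF tu0) implybT.
rewrite [leRHS]mulrCA -mulrA ler_wpM2l ?powR_ge0//.
apply: (@le_trans _ _ ((2 * rho) `^ (sigma - sigma') * rho `^ (- s))).
  by rewrite ler_wpM2r ?powR_ge0// ge0_ler_powR ?subr_ge0// ?nnegrE// ltW// mulr_gt0.
rewrite powRM ?(ltW rho0)// -mulrA ler_wpM2l ?powR_ge0//.
rewrite -powRD; last by rewrite (gt_eqF rho0) implybT.
by rewrite ger_powR ?rho0 ?(ltW rho1)//; lra.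
Qed.

End MicrolocalBound.

(** * Dyadic chaining *)

Lemma dyadic_scale {R : realType} (n : nat) (x : R) : 0 < x < 2 ^- n ->
  exists2 m, (n <= m)%N & 2 ^- m.+1 <= x < 2 ^- m.
Proof.
move=> /andP[x0 xn]; have exN : exists N, 2 ^- N <= x.
  have [N _ /(_ N (leqnn N))] := near_infty_natSinv_expn_lt (PosNum x0).
  by rewrite div1r => /ltW; exists N.
have anti k l : (k <= l)%N -> 2 ^- l <= 2 ^- k :> R.
  by move=> kl; rewrite lef_pV2 ?posrE ?exprn_gt0// ler_eXn2l ?ltr1n.
case: (ex_minnP exN) => -[|m] mx mmin.
  by move: xn; rewrite ltNge (le_trans _ mx)// anti.
exists m; last by rewrite mx ltNge; apply/negP => /mmin; rewrite ltnn.
by rewrite leqNgt; apply/negP => mn; move: xn; rewrite ltNge (le_trans _ mx)// anti.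
Qed.

Section DyadicChaining.
Context {R : realType}.

Definition dyadic_floor (m : nat) (x : R) : R := (Num.floor (x * 2 ^+ m))%:~R / 2 ^+ m.

Lemma dyadic_floor_dist (m : nat) (x : R) :
  dyadic_floor m x <= x < dyadic_floor m x + 2 ^- m.
Proof.
have /andP[fl fg] := floor_itv (x * 2 ^+ m).
have m0 : 0 < 2 ^+ m :> R by rewrite exprn_gt0.
rewrite /dyadic_floor ler_pdivrMr// fl /= -[X in _ + X]mul1r -mulrDl ltr_pdivlMr//.
by rewrite -[X in _ + X]/(1%:~R) -rmorphD.
Qed.

(** For n <= m the endpoint - 2^-n is itself a multiple of 2^-m, so rounding down cannot cross
    it. *)
Lemma dyadic_floor_le (n m : nat) (x : R) : (n <= m)%N -> `|x| < 2 ^- n ->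
  `|dyadic_floor m x| <= 2 ^- n.
Proof.
move=> nm; rewrite ltr_norml => /andP[xl xu].
have m0 : 0 < 2 ^+ m :> R by rewrite exprn_gt0.
have mn : 2 ^- n * 2 ^+ m = (2 ^ (m - n))%N%:Z%:~R :> R.
  by rewrite -[in LHS](subnK nm) exprD mulrC mulfK ?expf_neq0// -natrX.
have /andP[dl du] := dyadic_floor_dist m x.
rewrite ler_norml (le_trans dl (ltW xu)) andbT /dyadic_floor ler_pdivlMr//.
rewrite mulNr mn -rmorphN ler_int floor_ge_int rmorphN /= -mn -mulNr.
by rewrite ler_wpM2r// ltW.
Qed.

(** Both floors are written over the finer denominator, so that refining by one level costs at most
    one elementary increment. *)
Lemma dyadic_floorS (m : nat) (x : R) :
  let j := 2 * Num.floor (x * 2 ^+ m) in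
  dyadic_floor m x = j%:~R / 2 ^+ m.+1 /\
  (dyadic_floor m.+1 x = j%:~R / 2 ^+ m.+1 \/
   dyadic_floor m.+1 x = (j + 1)%:~R / 2 ^+ m.+1).
Proof.
move=> j; have m0 : 2 ^+ m != 0 :> R by rewrite expf_neq0.
have /andP[fl fg] := floor_itv (x * 2 ^+ m).
split; first by rewrite /dyadic_floor /j exprS intrM; field.
have : (j <= Num.floor (x * 2 ^+ m.+1) < j + 2)%R.
  rewrite floor_ge_int floor_lt_int exprS mulrCA /j intrD !intrM.
  by move: fl fg; rewrite intrD; set a := _%:~R; set b := x * _ => *; apply/andP; split; lra.
set k := Num.floor _ => jk.
have : k = j \/ k = j + 1 by lia.
by rewrite /dyadic_floor -/k => -[->|->]; [left|right].
Qed.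

Variables (f : R -> R) (n : nat) (A q : R).
Hypotheses (cf : continuous f) (A0 : 0 <= A) (q01 : 0 < q < 1).
Hypothesis fA : forall (m : nat) (j : int), (n <= m)%N -> `|j%:~R / 2 ^+ m| <= 2 ^- n :> R ->
  `|f ((j + 1)%:~R / 2 ^+ m) - f (j%:~R / 2 ^+ m)| <= A * q ^+ m.

(** [B * q ^+ m] is the geometric tail, the sum of q^i over i > m. *)
Let B := q / (1 - q).

Lemma dyadic_floor_chain (m k : nat) (x : R) : (n <= m)%N -> `|x| < 2 ^- n ->
  `|f (dyadic_floor (m + k) x) - f (dyadic_floor m x)| <= A * (B * (q ^+ m - q ^+ (m + k))).
Proof.
move=> nm xn; have /andP[q0 q1] := q01.
elim: k => [|k IH]; first by rewrite addn0 !subrr normr0 !mulr0.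
rewrite addnS; have nmk : (n <= m + k)%N by rewrite (leq_trans nm) ?leq_addr.
have step : `|f (dyadic_floor (m + k).+1 x) - f (dyadic_floor (m + k) x)| <=
    A * q ^+ (m + k).+1.
  have [d0 d1] := dyadic_floorS (m + k) x; have := dyadic_floor_le _ _ _ nmk xn.
  rewrite d0; set j := 2 * _ in d0 d1 * => jn; case: d1 => ->.
    by rewrite subrr normr0 mulr_ge0// exprn_ge0// ltW.
  by apply: fA => //; rewrite (leq_trans nmk).
have := ler_distD (f (dyadic_floor (m + k) x)) (f (dyadic_floor (m + k).+1 x)) (f (dyadic_floor m x)).
move=> /le_trans; apply; apply: (le_trans (lerD step IH)).
rewrite -mulrDr ler_wpM2l// le_eqVlt; apply/orP; left; apply/eqP.
by rewrite /B exprS; field; rewrite subr_eq0 gt_eqF.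
Qed.

(** The chain bound is uniform in the number of levels, and the floors converge to [x]; continuity
    passes the bound to the limit. *)
Lemma dyadic_floor_cvg (m : nat) (x : R) : (n <= m)%N -> `|x| < 2 ^- n ->
  `|f x - f (dyadic_floor m x)| <= A * B * q ^+ m.
Proof.
move=> nm xn; have /andP[q0 q1] := q01; apply/ler_addgt0Pr => e e0.
have /cvgrPdist_lt /(_ e e0) [dl /= dl0 fdl] := cf x.
have [N _ Ndl] := near_infty_natSinv_expn_lt (PosNum dl0).
have fN : `|f x - f (dyadic_floor (m + N) x)| < e.
  apply: fdl => /=; have /andP[dx xd] := dyadic_floor_dist (m + N) x.
  rewrite ger0_norm ?subr_ge0// ltrBlDl (lt_trans xd)// ltrD2l -div1r.
  by apply: Ndl => /=; exact: leq_addl.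
have := ler_distD (f (dyadic_floor (m + N) x)) (f x) (f (dyadic_floor m x)).
move=> /le_trans; apply; rewrite addrC; apply: lerD (ltW fN).
apply: (le_trans (dyadic_floor_chain _ _ _ nm xn)); rewrite -mulrA ler_wpM2l//.
rewrite ler_wpM2l ?divr_ge0 ?subr_ge0 ?(ltW q0) ?(ltW q1)//.
by rewrite lerBlDr lerDl exprn_ge0// ltW.
Qed.

(** At a level where the floors of [x] and [y] coincide or are adjacent, two chains cost [2 * B] and
    the middle increment costs 1, in units of [A * q ^+ m]. *)
Lemma dyadic_chaining_lt (x y : R) : `|x| < 2 ^- n -> `|y| < 2 ^- n -> x < y ->
  exists2 m : nat, 2 ^- m.+1 <= y - x & `|f x - f y| <= A * (2 * B + 1) * q ^+ m.
Proof.
move=> xn yn xy; have /andP[q0 q1] := q01.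
have [m [nm mxy floorxy]] : exists m, [/\ (n <= m)%N, 2 ^- m.+1 <= y - x &
    (Num.floor (x * 2 ^+ m) <= Num.floor (y * 2 ^+ m) <= Num.floor (x * 2 ^+ m) + 1)%R].
  have floor_le k : Num.floor (x * 2 ^+ k) <= Num.floor (y * 2 ^+ k).
    by apply: le_floor; rewrite ler_wpM2r ?exprn_ge0// ltW.
  (* For distant points level [n] works: both lie in ]- 2^-n, 2^-n[, so their floors have index -1
     or 0. Otherwise 2^-m is taken just above y - x. *)
  have [xyn|xyn] := leP (2 ^- n) (y - x).
    exists n; split => //.
      by rewrite (le_trans _ xyn)// lef_pV2 ?posrE ?exprn_gt0// ler_eXn2l ?ltr1n.
    rewrite floor_le /=; have n0 : 0 < 2 ^+ n :> R by rewrite exprn_gt0.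
    have : Num.floor (y * 2 ^+ n) < 1.
      by rewrite floor_lt_int -ltr_pdivlMr// mul1r (le_lt_trans (ler_norm _) yn).
    have : -1 <= Num.floor (x * 2 ^+ n).
      by rewrite floor_ge_int -ler_pdivrMr// mulN1r; move: xn; rewrite ltr_norml => /andP[/ltW].
    lia.
  have [|m nm /andP[mxy mxy']] := dyadic_scale n (y - x); first by rewrite subr_gt0 xy.
  exists m; split; rewrite ?floor_le//=.
  have m0 : 0 < 2 ^+ m :> R by rewrite exprn_gt0.
  suff : Num.floor (y * 2 ^+ m) < Num.floor (x * 2 ^+ m) + 1 + 1 by lia.
  rewrite floor_lt_int; have := floorD1_gt (x * 2 ^+ m).
  move: mxy'; rewrite -[2 ^- m]mul1r ltr_pdivlMr// mulrBl [in X in _ -> _ -> X]intrD; lra.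
exists m => //.
have fxy : `|f (dyadic_floor m x) - f (dyadic_floor m y)| <= A * q ^+ m.
  have := dyadic_floor_le _ _ _ nm xn.
  rewrite /dyadic_floor; set j := Num.floor _ in floorxy *; set k := Num.floor _ in floorxy *.
  move=> jn; have [->|->] : k = j \/ k = j + 1 by lia.
    by rewrite subrr normr0 mulr_ge0// exprn_ge0// ltW.
  by rewrite distrC fA.
have := dyadic_floor_cvg _ _ nm xn; have := dyadic_floor_cvg _ _ nm yn.
have := ler_distD (f (dyadic_floor m x)) (f x) (f y).
have := ler_distD (f (dyadic_floor m y)) (f (dyadic_floor m x)) (f y).
rewrite (distrC (f (dyadic_floor m y))).
rewrite (_ : A * (2 * B + 1) * q ^+ m = A * B * q ^+ m + A * B * q ^+ m + A * q ^+ m); last by ring.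
by move: fxy; move: (A * B * q ^+ m) (A * q ^+ m) => *; lra.
Qed.

End DyadicChaining.

Lemma dyadic_chaining {R : realType} (f : R -> R) (n : nat) (A sigma : R) :
  continuous f -> 0 <= A -> 0 < sigma ->
  (forall (m : nat) (j : int), (n <= m)%N -> `|j%:~R / 2 ^+ m| <= 2 ^- n :> R ->
    `|f ((j + 1)%:~R / 2 ^+ m) - f (j%:~R / 2 ^+ m)| <= A * (2 `^ (- sigma)) ^+ m) ->
  forall x y : R, `|x| < 2 ^- n -> `|y| < 2 ^- n ->
  `|f x - f y| <=
    A * (2 * (2 `^ (- sigma) / (1 - 2 `^ (- sigma))) + 1) / 2 `^ (- sigma) * `|x - y| `^ sigma.
Proof.
move=> cf A0 s0; set q := 2 `^ (- sigma) => fA.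
have q0 : 0 < q by rewrite powR_gt0.
have q1 : q < 1.
  rewrite /q powRN invf_lt1 ?powR_gt0//.
  suff : 1 `^ sigma < 2 `^ sigma by rewrite powR1.
  by apply: gt0_ltr_powR => //; rewrite ?nnegrE ?ler0n ?ltr1n.
have q01 : 0 < q < 1 by rewrite q0.
have C0 : 0 <= A * (2 * (q / (1 - q)) + 1).
  by rewrite mulr_ge0// addr_ge0// mulr_ge0// divr_ge0 ?subr_ge0 ?(ltW q0) ?(ltW q1).
have lt_case x y : `|x| < 2 ^- n -> `|y| < 2 ^- n -> x < y ->
    `|f x - f y| <= A * (2 * (q / (1 - q)) + 1) / q * `|x - y| `^ sigma.
  move=> xn yn xy; have [m mxy /le_trans] := dyadic_chaining_lt _ _ _ _ cf A0 q01 fA _ _ xn yn xy.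
  apply; move: C0; set M := A * _ => M0.
  (* Dividing by [q] pays for the shift from m to m + 1: q^(m + 1) is the power sigma of 2^-(m + 1),
     which is at most y - x. *)
  rewrite -mulrA ler_wpM2l// mulrC ler_pdivlMr// -exprSr distrC gtr0_norm ?subr_gt0//.
  apply: (@le_trans _ _ ((2 ^- m.+1) `^ sigma)); last first.
    by rewrite ge0_ler_powR ?(ltW s0)// nnegrE ?invr_ge0 ?exprn_ge0// subr_ge0 ltW.
  rewrite /q -(powR_mulrn m.+1 (powR_ge0 _ _)) -powRrM -(powR_invn m.+1 (ler0n R 2)).
  by rewrite -powRrM (_ : 1 *- m.+1 * sigma = - sigma * m.+1%:R)//; ring.
move=> x y xn yn; have [xy|yx|->] := ltgtP x y.
- exact: lt_case.
- by rewrite distrC (distrC x); exact: lt_case.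
- by rewrite !subrr normr0 mulr_ge0 ?powR_ge0// divr_ge0// ltW.
Qed.

(** * Variance of increments *)

Lemma powR_small {R : realType} (p e : R) : 0 < p -> 0 < e ->
  exists2 x0 : R, 0 < x0 & forall x, 0 <= x <= x0 -> x `^ p <= e.
Proof.
move=> p0 e0; exists (e `^ p^-1); first by rewrite powR_gt0.
move=> x /andP[x0 xe]; apply: (@le_trans _ _ ((e `^ p^-1) `^ p)).
  by rewrite ge0_ler_powR ?nnegrE ?powR_ge0// ltW.
by rewrite -powRrM mulVf ?gt_eqF// powRr1// ltW.
Qed.

Section IncrementVariance.
Context {R : realType} {d : measure_display} {T : measurableType d}.
Variables (P : probability T R) (H : R -> R) (X : R -> {RV P >-> R}) (t0 : R).
Hypothesis t00 : 0 <= t0.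

Definition variance_bounds (V : R -> R -> R) (k C r : R) := forall t u : R,
  Rplus_ball t0 r t -> Rplus_ball t0 r u ->
  ('E_P[fun w => ((X t w - X u w) ^+ 2)%R] = (V t u)%:E)%E /\
  k * (`|t - u| `^ (2 * H t) + (H t - H u) ^+ 2) <= V t u
    <= C * (`|t - u| `^ (2 * H t) + (H t - H u) ^+ 2).

(** Near [t0] the remainders are at most K / 2 and L / 2 times their comparison terms, hence
    absorbed by the main terms. *)
Lemma increment_variance_bounds : increment_variance H X t0 ->
  exists V k C r, [/\ 0 < k, 0 < C, 0 < r & variance_bounds V k C r].
Proof.
move=> [K [L [r1 [r2 [K0 L0 /eqoP o1 /eqoP o2 EV]]]]].
have [r r0 hr] : exists2 r : R, 0 < r & forall t u, Rplus_ball t0 r t -> Rplus_ball t0 r u ->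
    [/\ `|r1 (t, u)| <= K / 2 * `| `|t - u| `^ (2 * H t)|,
        `|r2 (t, u)| <= L / 2 * `|(H t - H u) ^+ 2| &
        ('E_P[fun w => ((X t w - X u w) ^+ 2)%R] =
        (K * `|t - u| `^ (2 * H t) + L * (H t - H u) ^+ 2 + r1 (t, u) + r2 (t, u))%R%:E)%E].
  have K20 : 0 < K / 2 by rewrite divr_gt0.
  have L20 : 0 < L / 2 by rewrite divr_gt0.
  have h1 : \forall p \near (t0, t0), 0 <= p.1 /\ 0 <= p.2 ->
    `|r1 p| <= K / 2 * `| `|p.1 - p.2| `^ (2 * H p.1)| := o1 _ K20.
  have h2 : \forall p \near (t0, t0), 0 <= p.1 /\ 0 <= p.2 ->
    `|r2 p| <= L / 2 * `|(H p.1 - H p.2) ^+ 2| := o2 _ L20.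
  have [[Q1 Q2] [/= /nbhs_ballP[e1 /= e10 Qe1] /nbhs_ballP[e2 /= e20 Qe2]] hQ] :=
    filterI h1 (filterI h2 EV).
  exists (Num.min e1 e2); first by rewrite lt_min e10.
  move=> t u [t0' tr] [u0' ur].
  have [|g1 [g2 g3]] := hQ (t, u).
    move: tr ur; rewrite !lt_min => /andP[tr _] /andP[_ ur].
    by split; [apply: Qe1|apply: Qe2]; rewrite /ball /= distrC.
  by split; [apply: g1|apply: g2|apply: g3].
exists (fun t u => K * `|t - u| `^ (2 * H t) + L * (H t - H u) ^+ 2 + r1 (t, u) + r2 (t, u)).
exists (Num.min K L / 2), (2 * (K + L)), r; split => //.
- by rewrite divr_gt0// lt_min K0.
- by rewrite mulr_gt0// addr_gt0.
move=> t u tb ub; have [h1 h2 h3] := hr t u tb ub; split => //.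
move: h1 h2; rewrite (ger0_norm (powR_ge0 _ _)) (ger0_norm (sqr_ge0 _)).
have := powR_ge0 `|t - u| (2 * H t); have := sqr_ge0 (H t - H u).
set a := _ `^ _; set b := _ ^+ 2; move=> b0 a0.
have : Num.min K L <= K by rewrite ge_min lexx.
have : Num.min K L <= L by rewrite ge_min lexx orbT.
move: (Num.min K L) => k kL kK.
rewrite !ler_norml => /andP[? ?] /andP[? ?].
have kKa : k * a <= K * a by rewrite ler_wpM2r.
have kLb : k * b <= L * b by rewrite ler_wpM2r.
have Kb : 0 <= K * b by rewrite mulr_ge0// ltW.
have La : 0 <= L * a by rewrite mulr_ge0// ltW.
have Ka : 0 <= K * a by rewrite mulr_ge0// ltW.
have Lb : 0 <= L * b by rewrite mulr_ge0// ltW.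
by apply/andP; split; lra.
Qed.

Variables (V : R -> R -> R) (k C r0 : R).
Hypotheses (k0 : 0 < k) (C0 : 0 < C) (r00 : 0 < r0) (VP : variance_bounds V k C r0).

Lemma variance_diag t : Rplus_ball t0 r0 t -> V t t = 0.
Proof.
move=> tb; have [+ _] := VP t t tb tb.
rewrite (_ : (fun w => _) = cst 0); last by apply/funext => w; rewrite subrr expr0n.
by rewrite expectation_cst => -[].
Qed.

Lemma variance_to_microlocal (s sigma M r : R) : 0 < r -> 0 <= M ->
  (forall rho t u, 0 < rho < r -> Rplus_ball t0 rho t -> Rplus_ball t0 rho u ->
     V t u <= (M * (`|t - u| `^ sigma * rho `^ (- s))) ^+ 2) ->
  microlocal H t0 s sigma /\ sigma <= H t0 + s.
Proof.
move=> r0' M0 VM; have mr0 : 0 < Num.min r r0 by rewrite lt_min r0'.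
have kV rho t u : 0 < rho < Num.min r r0 -> Rplus_ball t0 rho t -> Rplus_ball t0 rho u ->
   k * (`|t - u| `^ (2 * H t) + (H t - H u) ^+ 2) <=
   (M * (`|t - u| `^ sigma * rho `^ (- s))) ^+ 2.
  move=> /andP[rho0]; rewrite lt_min => /andP[rhor rhor0] tb ub.
  apply: (le_trans _ (VM rho t u _ tb ub)); last by rewrite rho0.
  have sub x : Rplus_ball t0 rho x -> Rplus_ball t0 r0 x.
    by move=> [x0 xr]; split => //; exact: lt_trans xr rhor0.
  by have [_ /andP[]] := VP t u (sub _ tb) (sub _ ub).
split.
  (* The factor 1 + 1 / k replaces a square root, since 1 / k <= (1 + 1 / k)^2. *)
  exists (M * (1 + k^-1)), (Num.min r r0); split => //.
    by rewrite mulr_ge0// addr_ge0// invr_ge0 ltW.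
  move=> rho t u rho0r tb ub; have kHy := kV rho t u rho0r tb ub.
  have rhs0 : 0 <= M * (`|t - u| `^ sigma * rho `^ (- s)).
    by rewrite !mulr_ge0 ?powR_ge0.
  rewrite -mulrA mulrCA; move: rhs0 kHy; set y := M * _ => y0 kHy.
  have k10 : 0 <= 1 + k^-1 by rewrite addr_ge0// invr_ge0 ltW.
  rewrite -ler_sqr ?nnegrE ?mulr_ge0 ?powR_ge0// real_normK ?num_real// exprMn.
  apply: (@le_trans _ _ (k^-1 * y ^+ 2)).
    rewrite mulrC ler_pdivlMr// mulrC; apply: le_trans kHy.
    by rewrite ler_wpM2l ?(ltW k0)// lerDr powR_ge0.
  rewrite ler_wpM2r ?sqr_ge0//; have : 0 < k^-1 by rewrite invr_gt0.
  by move: k^-1 => i i0; rewrite expr2; nra.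
(* Otherwise the pair t0, t0 + x with rho = 2 x gives k x^(2 H(t0)) <= M^2 2^(-2 s) x^(2 (sigma -
   s)), which fails for small x. Moving to the right of [t0] stays in the half-line. *)
rewrite leNgt; apply/negP => Hs.
have dl0 : 0 < 2 * (sigma - s - H t0) by lra.
(* Adding 1 makes [M'] positive and the final comparison strict. *)
pose M' := (M * 2 `^ (- s)) ^+ 2 + 1.
have M'0 : 0 < M' by rewrite ltr_wpDl// sqr_ge0.
have e0 : 0 < k / M' by rewrite divr_gt0.
have [x0 x00 xk] := powR_small _ _ dl0 e0.
pose x := Num.min x0 (Num.min r r0 / 4).
have x_gt0 : 0 < x by rewrite lt_min x00 divr_gt0.
have xr : 2 * x < Num.min r r0.
  have : x <= Num.min r r0 / 4 by rewrite ge_min lexx orbT.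
  by move: mr0; move: (Num.min r r0) (x) => *; lra.
have bx : `|t0 - (t0 + x)| = x by rewrite opprD addNKr normrN gtr0_norm.
have b1 : Rplus_ball t0 (2 * x) t0 by split; rewrite ?subrr ?normr0 ?mulr_gt0.
have b2 : Rplus_ball t0 (2 * x) (t0 + x).
  split; first by rewrite addr_ge0// ltW.
  by rewrite distrC bx; move: x_gt0; move: (x) => *; lra.
have x2r : 0 < 2 * x < Num.min r r0 by rewrite mulr_gt0.
have := kV (2 * x) t0 (t0 + x) x2r b1 b2; rewrite bx.
apply/negP; rewrite -ltNge powRM ?(ltW x_gt0)//.
have x2H : 0 < x `^ (2 * H t0) by rewrite powR_gt0.
have -> : (M * (x `^ sigma * (2 `^ (- s) * x `^ (- s)))) ^+ 2 =
    (M * 2 `^ (- s)) ^+ 2 * (x `^ (2 * (sigma - s - H t0)) * x `^ (2 * H t0)).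
  rewrite -powRD ?(gt_eqF x_gt0) ?implybT//.
  rewrite (_ : 2 * _ + _ = (sigma - s) * 2%:R); last by ring.
  rewrite powRrM powR_mulrn ?powR_ge0// powRD ?(gt_eqF x_gt0) ?implybT//.
  by ring.
have xd : M' * x `^ (2 * (sigma - s - H t0)) <= k.
  rewrite mulrC -ler_pdivlMr//; apply: xk.
  by rewrite (ltW x_gt0) ge_min lexx.
apply: (@lt_le_trans _ _ (M' * x `^ (2 * (sigma - s - H t0)) * x `^ (2 * H t0))).
  by rewrite mulrA ltr_pM2r// ltr_pM2r ?powR_gt0// ltrDl.
apply: (@le_trans _ _ (k * x `^ (2 * H t0))); first by rewrite ler_wpM2r// ltW.
by rewrite ler_wpM2l ?(ltW k0)// lerDl sqr_ge0.
Qed.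

(** Regularity of [H] handles its own term of the variance. It also keeps H(t) above sigma - s near
    [t0], which turns |t - u|^(2 H(t)) into |t - u|^(2 sigma) (2 rho)^(-2 s). *)
Lemma microlocal_to_variance (s sigma : R) :
  s < 0 -> 0 < sigma -> sigma < H t0 + s -> microlocal H t0 s sigma ->
  exists C' r : R, [/\ 0 < C', 0 < r, r <= r0 & forall rho t u : R, 0 < rho < r ->
    Rplus_ball t0 rho t -> Rplus_ball t0 rho u ->
    V t u <= C' * (`|t - u| `^ sigma * rho `^ (- s)) ^+ 2].
Proof.
move=> s0 sg0 sgH [M [rH [M0 rH0 HM]]].
have h0 : 0 < sigma - s by lra.
(* For rho^(sigma - s) below this threshold, H(t) deviates from H(t0) by less than the gap H(t0) -
   (sigma - s). The further bound rho < 1 / 2 ensures |t - u| <= 1. *)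
have e0 : 0 < (H t0 - (sigma - s)) / (M + 1).
  by apply: divr_gt0; [lra|rewrite ltr_wpDl].
have [x0 x00 xsmall] := powR_small _ _ h0 e0.
exists (C * ((2 `^ (- s)) ^+ 2 + M ^+ 2)), (Num.min (Num.min rH r0) (Num.min x0 (1 / 2))).
split.
- by rewrite mulr_gt0// ltr_pwDl ?sqr_ge0// exprn_gt0// powR_gt0.
- by rewrite !lt_min rH0 r00 x00 divr_gt0.
- by rewrite !ge_min lexx orbT.
move=> rho t u /andP[rho0]; rewrite !lt_min => /andP[/andP[rhoH rhor] /andP[rhox rho2]] tb ub.
have tb0 : Rplus_ball t0 r0 t by case: tb => ? /lt_trans; split => //; auto.
have ub0 : Rplus_ball t0 r0 u by case: ub => ? /lt_trans; split => //; auto.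
have [tu|tu] := eqVneq t u.
  rewrite -tu variance_diag// mulr_ge0 ?sqr_ge0// ltW// mulr_gt0//.
  by rewrite ltr_pwDl ?sqr_ge0// exprn_gt0// powR_gt0.
have tu0 : 0 < `|t - u| by rewrite normr_gt0 subr_eq0.
have tu2 : `|t - u| <= 2 * rho.
  case: tb ub => _ tb [_ ub]; have := ler_distD t0 t u; rewrite (distrC t0); lra.
have [_ /andP[_ /le_trans]] := VP t u tb0 ub0; apply.
rewrite -mulrA ler_wpM2l ?(ltW C0)// (mulrDl (_ ^+ 2)); apply: lerD; last first.
  rewrite -exprMn -(real_normK (num_real (H t - H u))).
  by rewrite lerXn2r ?nnegrE ?mulr_ge0 ?powR_ge0// HM ?rho0.
have hHt : sigma - s <= H t.
  have t0b : Rplus_ball t0 rho t0 by split; rewrite ?subrr ?normr0.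
  have := HM rho t t0; rewrite rho0 rhoH => /(_ isT tb t0b).
  have tt0 : `|t - t0| `^ sigma <= rho `^ sigma.
    by rewrite ge0_ler_powR ?(ltW sg0)// ?nnegrE ?(ltW rho0)//; case: tb => _ /ltW.
  have : M * (`|t - t0| `^ sigma * rho `^ (- s)) <= M * (rho `^ (sigma - s)).
    rewrite ler_wpM2l// powRD ?(gt_eqF rho0) ?implybT//.
    by rewrite ler_wpM2r ?powR_ge0.
  have : (M + 1) * rho `^ (sigma - s) <= H t0 - (sigma - s).
    by rewrite mulrC -ler_pdivlMr ?ltr_wpDl//; apply: xsmall; rewrite !ltW.
  have := powR_ge0 rho (sigma - s).
  rewrite mulrDl mul1r ler_norml => ? ? ? /andP[? ?].
  lra.
apply: (@le_trans _ _ (`|t - u| `^ (2 * (sigma - s)))).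
  by rewrite ger_powR ?tu0//=; [lra|rewrite ler_pM2l].
rewrite (_ : 2 * (sigma - s) = (sigma - s) * 2%:R); last by ring.
rewrite powRrM powR_mulrn ?powR_ge0// -exprMn lerXn2r ?nnegrE ?mulr_ge0 ?powR_ge0//.
rewrite powRD ?(gt_eqF tu0) ?implybT// mulrCA ler_wpM2l ?powR_ge0//.
rewrite -powRM ?(ltW rho0)// ge0_ler_powR ?nnegrE ?mulr_ge0 ?(ltW rho0)//.
by rewrite oppr_ge0 ltW.
Qed.

Hypothesis gaussX : forall t u, 0 <= t -> 0 <= u -> gaussian_limit P (X t \- X u)%R.

(** By contraposition of [variance_to_microlocal], the variance of some increments is arbitrarily
    large compared with the squared modulus. Bounded density then makes it improbable that those
    increments obey the modulus. *)
Lemma not_microlocal_ae (s sigma : R) :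
  ~ (microlocal H t0 s sigma /\ sigma <= H t0 + s) ->
  {ae P, forall w, ~ microlocal (fun t => X t w) t0 s sigma}.
Proof.
move=> nHs.
have boundP n : {ae P, forall w,
    ~ microlocal_bound (fun t => X t w) t0 s sigma n.+1%:R n.+1%:R^-1}.
  (* The event quantifies over uncountably many pairs, so it is enclosed in measurable events, each
     about a single increment and of probability O(1 / (i + 1)). *)
  have exG i : exists G : set T, [/\ measurable G,
      (P G <= (24 * n.+1%:R / i.+1%:R)%:E)%E &
      [set w | microlocal_bound (fun t => X t w) t0 s sigma n.+1%:R n.+1%:R^-1] `<=` G].
    apply: contrapT => nG; apply: nHs; have M0 : 0 <= i.+1%:R :> R by [].
    have r0' : 0 < Num.min n.+1%:R^-1 r0 by rewrite lt_min invr_gt0 ltr0n.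
    apply: (variance_to_microlocal _ _ _ _ r0' M0) => rho t u /andP[rho0].
    rewrite lt_min => /andP[rhon rhor] tb ub; rewrite leNgt; apply/negP => MV.
    have tb0 : Rplus_ball t0 r0 t by case: tb => ? /lt_trans; split => //; auto.
    have ub0 : Rplus_ball t0 r0 u by case: ub => ? /lt_trans; split => //; auto.
    have tu : t != u.
      by apply/negP => /eqP tu; move: MV; rewrite -tu variance_diag// ltNge sqr_ge0.
    move: MV; set c := _ * rho `^ _ => MV.
    have c0 : 0 < c by rewrite mulr_gt0 ?powR_gt0// normr_gt0 subr_eq0.
    apply: nG; exists [set w | `|(X t \- X u)%R w| <= n.+1%:R * c]; split.
    - exact: measurable_norm_le.
    - have V0 : 0 < V t u by rewrite (le_lt_trans _ MV)// sqr_ge0.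
      have [EV _] := VP t u tb0 ub0.
      have nc0 : 0 < n.+1%:R * c by rewrite mulr_gt0.
      have VE : ((V t u)%:E <= 'E_P[fun w => ((X t \- X u)%R w ^+ 2)%R])%E by rewrite -EV.
      apply: (le_trans (gaussian_limit_small P _ _ _ (gaussX _ _ tb.1 ub.1) V0 VE nc0)).
      rewrite lee_fin mulrA -mulrA ler_wpM2l ?mulr_ge0// ler_pdivrMr ?sqrtr_gt0//.
      rewrite mulrC ler_pdivlMr// mulrC -(ger0_norm (mulr_ge0 M0 (ltW c0))) -sqrtr_sqr.
      by rewrite ler_sqrt// ltW.
    - by move=> w /= fb; apply: fb => //; rewrite rho0.
  have [G Gi] := choice exG; exists (\bigcap_i G i); split.
  - by apply: bigcap_measurable => // i _; have [] := Gi i.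
  - apply/eqP; rewrite eq_le measure_ge0 andbT; apply/lee_addgt0Pr => e e0; rewrite add0e.
    have [i iE] : exists i : nat, 24 * n.+1%:R / i.+1%:R <= e.
      have e24 : 0 < e / (24 * n.+1%:R) by rewrite divr_gt0// mulr_gt0.
      have [i _ /(_ i (leqnn i))/= iE] := near_infty_natSinv_lt (PosNum e24).
      by exists i; rewrite mulrC -ler_pdivlMr ?mulr_gt0// ltW.
    have [_ PG _] := Gi i.
    apply: (@le_trans _ _ (P (G i))); last by rewrite (le_trans PG)// lee_fin.
    apply: le_measure; rewrite ?inE; [|by have [] := Gi i|exact: bigcap_inf].
    by apply: bigcap_measurable => // l _; have [] := Gi l.
  - by move=> w /= /contrapT wb i _; have [_ _] := Gi i; apply.
(* Any constant [c] and radius [r] are covered by n + 1 and 1 / (n + 1) for a large n. *)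
have := ae_foralln boundP; apply: filterS => w wb [c [r [c0' r0' fb]]].
have [n cn] : exists2 n : nat, c <= n.+1%:R & n.+1%:R^-1 <= r.
  have [i _ ir] := near_infty_natSinv_lt (PosNum r0').
  have ci := archi_boundP c0'; exists (maxn i (Num.bound c)).
    by rewrite (le_trans (ltW ci))// ler_nat leqW// leq_maxr.
  by apply: ltW; apply: ir => /=; rewrite leq_maxl.
move=> nr; apply: (wb n) => rho t u /andP[rho0 rhon] tb ub.
apply: (le_trans (fb rho t u _ tb ub)); first by rewrite rho0 (lt_le_trans rhon).
by rewrite ler_wpM2r// mulr_ge0// powR_ge0.
Qed.

End IncrementVariance.

(** * Regularity of the paths *)

(** Choose N with q^N >= 4, so that 4^m <= (q^m)^N; an exponential dominates this power through e^y
    >= (y / (N + 1))^N. *)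
Lemma exp_geometric {R : realType} (c q : R) : 0 < c -> 1 < q ->
  exists2 K : R, 0 <= K & forall m, 4 ^+ m * expR (- (c * q ^+ m)) <= K.
Proof.
move=> c0 q1; have q0 : 0 < q by apply: lt_trans q1.
have [N Nq] : exists N, 4 <= q ^+ N.
  have [N _ /(_ N (leqnn N))] : \forall N \near \oo, `|0 - geometric 1 q^-1 N| < 1 / 4.
    have q1' : `|q^-1| < 1 by rewrite gtr0_norm ?invr_gt0// invf_lt1.
    by move/cvgrPdist_lt : (cvg_geometric 1 q1') => /(_ (1 / 4)); apply.
  rewrite /geometric /= mul1r sub0r normrN gtr0_norm ?exprn_gt0 ?invr_gt0// => qN.
  by exists N; rewrite -lef_pV2 ?posrE ?exprn_gt0// -exprVn ltW// -[4^-1]mul1r.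
exists ((N.+1%:R / c) ^+ N); first by rewrite exprn_ge0// divr_ge0// ltW.
move=> m; have cq0 : 0 < c * q ^+ m by rewrite mulr_gt0// exprn_gt0.
rewrite expRN ler_pdivrMr ?expR_gt0//.
have expN : (c * q ^+ m / N.+1%:R) ^+ N <= expR (c * q ^+ m).
  apply: (@le_trans _ _ (expR (c * q ^+ m / N.+1%:R) ^+ N)).
    rewrite lerXn2r ?nnegrE ?expR_ge0 ?divr_ge0 ?(ltW cq0)//.
    by rewrite (le_trans _ (expR_ge1Dx _))// lerDr.
  rewrite -expRM_natl ler_expR mulrCA ler_piMr ?(ltW cq0)//.
  by rewrite ler_pdivrMr// mul1r ler_nat.
apply: (@le_trans _ _ ((N.+1%:R / c) ^+ N * (c * q ^+ m / N.+1%:R) ^+ N)); last first.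
  by rewrite ler_wpM2l// exprn_ge0// divr_ge0// ltW.
have b0 : N.+1%:R != 0 :> R by rewrite pnatr_eq0.
rewrite -exprMn (_ : N.+1%:R / c * (c * q ^+ m / N.+1%:R) = q ^+ m); last first.
  by move: (N.+1%:R) (q ^+ m) b0 => b y b0; field; rewrite b0 gt_eqF.
by rewrite exprAC lerXn2r ?nnegrE// exprn_ge0// ltW.
Qed.

Lemma dist_max0_le {R : realType} (a b : R) :
  `|Num.max 0 a - Num.max 0 b| <= `|a - b|.
Proof.
have := ler_norm (a - b); have := ler_norm (b - a); rewrite (distrC b).
have [a0|a0] := leP 0 a; have [b0|b0] := leP 0 b => // ab ba; rewrite ?subrr ?normr0//.
- by rewrite subr0 ger0_norm//; lra.
- by rewrite sub0r normrN ger0_norm//; lra.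
Qed.

(** Clamping at 0 extends a path from the half-line to a continuous function on the whole line,
    centred at [t0], to which dyadic chaining applies. *)
Lemma continuous_reflected {R : realType} (f : R -> R) (t0 : R) :
  {within `[0, +oo[, continuous f} -> continuous (fun x => f (Num.max 0 (t0 + x))).
Proof.
move=> /subspace_continuousP cf x; apply/cvgrPdist_lt => e e0.
have gx : `[0%R, +oo[%classic (Num.max 0 (t0 + x)) by rewrite /= in_itv/= le_max lexx.
have /cvgrPdist_lt/(_ e e0) := cf _ gx.
rewrite /within /= => /nbhs_ballP[dl /= dl0 hdl].
exists dl => //= y xy; apply: hdl => /=; last by rewrite in_itv/= le_max lexx.
rewrite /ball /= (le_lt_trans (dist_max0_le _ _))//.
by rewrite opprD addrACA subrr add0r.
Qed.

Definition dyadic_point {R : realType} (t0 : R) (m : nat) (j : int) : R :=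
  Num.max 0 (t0 + j%:~R / 2 ^+ m).

(* The points of indices j and j + 1 are at distance less than this from t0. *)
Definition dyadic_radius {R : realType} (m : nat) (j : int) : R := (`|j%:~R| + 2) / 2 ^+ m.

Section HolderDyadic.
Context {R : realType}.
Variables (f : R -> R) (t0 s sigma r : R) (m0 : nat).
Hypotheses (s0 : s < 0) (sg0 : 0 < sigma) (r0 : 0 < r).


(** For 2^-(N + 1) <= rho < 2^-N, chaining is run on the ball of radius 2^-N. The radii attached to
    its dyadic points are at most 3 * 2^-N <= 6 rho, so since s < 0 one constant (6 rho)^(- s)
    serves at all levels m >= N. *)
Lemma dyadic_increments_microlocal :
  {within `[0, +oo[, continuous f} ->
  (forall (m : nat) (j : int), (m0 <= m)%N -> `|j%:~R| <= 2 ^+ m :> R -> dyadic_radius m j < r ->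
    `|f (dyadic_point t0 m (j + 1)) - f (dyadic_point t0 m j)| <= (2 `^ (- sigma)) ^+ m * dyadic_radius m j `^ (- s)) ->
  microlocal f t0 s sigma.
Proof.
move=> cf fd; have cF := continuous_reflected f t0 cf.
pose q : R := 2 `^ (- sigma).
pose C := (2 * (q / (1 - q)) + 1) / q.
have [n nm0 nr] : exists2 n, (m0 <= n)%N & 3 * 2 ^- n < r.
  have r30 : 0 < r / 3 by rewrite divr_gt0.
  have [N _ hN] := near_infty_natSinv_expn_lt (PosNum r30).
  exists (maxn m0 N); first by rewrite leq_maxl.
  by rewrite mulrC -ltr_pdivlMr// -div1r; apply: hN => /=; rewrite leq_maxr.
exists (`|C| * 6 `^ (- s)), (2 ^- n); split.
- by rewrite mulr_ge0// powR_ge0.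
- by rewrite invr_gt0 exprn_gt0.
move=> rho t u /[dup] /andP[rho0 _] /dyadic_scale[N nN /andP[rhoN Nrho]] tb ub.
pose A : R := (6 * rho) `^ (- s).
have FN (m : nat) (j : int) : (N <= m)%N -> `|j%:~R / 2 ^+ m| <= 2 ^- N :> R ->
    `|f (dyadic_point t0 m (j + 1)) - f (dyadic_point t0 m j)| <= A * (2 `^ (- sigma)) ^+ m.
  move=> Nm jN; have m20 : 0 < 2 ^+ m :> R by rewrite exprn_gt0.
  have N20 : 0 < 2 ^+ N :> R by rewrite exprn_gt0.
  have mN : 2 ^- m <= 2 ^- N :> R by rewrite lef_pV2 ?posrE// ler_eXn2l ?ltr1n.
  have Nn : 2 ^- N <= 2 ^- n :> R by rewrite lef_pV2 ?posrE ?exprn_gt0// ler_eXn2l ?ltr1n.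
  have jN' : `|j%:~R| / 2 ^+ m <= 2 ^- N :> R.
    by rewrite -[X in _ / X]ger0_norm ?(ltW m20)// -normf_div.
  have radN : dyadic_radius m j <= 3 * 2 ^- N :> R.
    rewrite /dyadic_radius. rewrite (mulrDl `|j%:~R| 2); lra.
  have rho2 : 2 ^- N <= 2 * rho by move: rhoN; rewrite exprS invfM; lra.
  apply: (le_trans (fd m j _ _ _)).
  - by rewrite (leq_trans nm0)// (leq_trans nN).
  - by move: jN'; rewrite ler_pdivrMr// => /le_trans; apply; rewrite ler_pdivrMl ?ler_peMl ?exprn_ege1 ?(ltW m20)// ler1n.
  - by rewrite (le_lt_trans radN)// (le_lt_trans _ nr)// ler_pM2l.
  rewrite mulrC ler_wpM2r ?exprn_ge0 ?powR_ge0// ge0_ler_powR ?nnegrE ?oppr_ge0 ?(ltW s0)//.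
  - by rewrite /dyadic_radius divr_ge0 ?addr_ge0 ?(ltW m20).
  - by rewrite mulr_ge0// ltW.
  - lra.
have A0 : 0 <= A by rewrite powR_ge0.
have := dyadic_chaining _ _ _ _ cF A0 sg0 FN (t - t0) (u - t0).
case: tb ub => t00' tr [u00' ur].
rewrite (lt_trans tr)// (lt_trans ur)// => /(_ isT isT).
rewrite !subrKC !max_r// opprB addrA subrK => /le_trans; apply.
rewrite -/q -(mulrA A) -/C; apply: (@le_trans _ _ (A * `|C| * `|t - u| `^ sigma)).
  by rewrite ler_wpM2r ?powR_ge0// ler_wpM2l// ler_norm.
rewrite /A powRM ?(ltW rho0)// le_eqVlt; apply/orP; left; apply/eqP.
by ring.
Qed.

End HolderDyadic.

(** * Borel-Cantelli argument for the dyadic increments of the process *)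

Section LowerBound.
Context {R : realType} {d : measure_display} {T : measurableType d}.
Variables (P : probability T R) (X : R -> {RV P >-> R}) (V : R -> R -> R).
Variables (t0 s sigma sigma1 C r : R).
Hypotheses (t00 : 0 <= t0) (s0 : s < 0) (sg0 : 0 < sigma) (sg1 : sigma < sigma1).
Hypotheses (C0 : 0 < C) (r0 : 0 < r).
Hypothesis gaussX : forall t u, 0 <= t -> 0 <= u -> gaussian_limit P (X t \- X u)%R.
Hypothesis EV : forall t u, Rplus_ball t0 r t -> Rplus_ball t0 r u ->
  ('E_P[fun w => ((X t w - X u w) ^+ 2)%R] = (V t u)%:E)%E.
Hypothesis VC : forall rho t u, 0 < rho < r -> Rplus_ball t0 rho t -> Rplus_ball t0 rho u ->
  V t u <= C * (`|t - u| `^ sigma1 * rho `^ (- s)) ^+ 2.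

Let q : R := 2 `^ (- sigma).

Definition bad_increment (m : nat) (j : int) : set T :=
  if dyadic_radius m j < r then
    [set w | q ^+ m * dyadic_radius m j `^ (- s) <= `|(X (dyadic_point t0 m (j + 1)) \- X (dyadic_point t0 m j))%R w|]
  else set0.

Lemma measurable_bad_increment m j : measurable (bad_increment m j).
Proof. by rewrite /bad_increment; case: ifP => // _; exact: measurable_norm_ge. Qed.

(** [Q ^+ m] is the squared ratio of 2^(- m sigma) to 2^(- m sigma1): the gain from the gap between
    the two exponents. *)
Let Q : R := 2 `^ (2 * (sigma1 - sigma)).

(** The power of the radius appears in both the threshold and the deviation and cancels in the
    exponent, so the bound is uniform in [j]. *)
Lemma bad_increment_le m j :
  (P (bad_increment m j) <= (2 * expR (- ((2048 * C)^-1 * Q ^+ m)))%:E)%E.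
Proof.
rewrite /bad_increment; case: ifPn => [radr|_]; last first.
  by rewrite measure0 lee_fin mulr_ge0 ?expR_ge0.
have m20 : 0 < 2 ^+ m :> R by rewrite exprn_gt0.
have m2V : 0 < 2 ^- m :> R by rewrite invr_gt0.
have rad0 : 0 < dyadic_radius m j :> R by rewrite /dyadic_radius divr_gt0// ltr_pwDr.
have ballj (l : int) : `|l%:~R| <= `|j%:~R| + 1 :> R -> Rplus_ball t0 (dyadic_radius m j) (dyadic_point t0 m l).
  move=> lj; split; first by rewrite le_max lexx.
  rewrite (le_lt_trans (_ : _ <= `|l%:~R / 2 ^+ m|))//; last first.
    by rewrite normf_div (ger0_norm (ltW m20)) /dyadic_radius ltr_pM2r ?invr_gt0//; lra.
  rewrite -[X in `|_ - X|](max_r t00) (le_trans (dist_max0_le _ _))//.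
  by rewrite addrC addKr.
have b0 : Rplus_ball t0 (dyadic_radius m j) (dyadic_point t0 m j) by apply: ballj; rewrite lerDl.
have b1 : Rplus_ball t0 (dyadic_radius m j) (dyadic_point t0 m (j + 1)).
  by apply: ballj; rewrite rmorphD /= (le_trans (ler_normD _ _))// normr1.
have inr x : Rplus_ball t0 (dyadic_radius m j) x -> Rplus_ball t0 r x.
  by case=> ? /lt_trans; split => //; auto.
have dist : `|dyadic_point t0 m (j + 1) - dyadic_point t0 m j| <= 2 ^- m.
  rewrite (le_trans (dist_max0_le _ _))// opprD addrACA subrr add0r -mulrBl rmorphD /=.
  by rewrite addrC addKr mul1r gtr0_norm.
set thr := q ^+ m * _.
have thr0 : 0 < thr by rewrite mulr_gt0 ?exprn_gt0 ?powR_gt0.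
pose v := C * ((2 ^- m) `^ sigma1 * dyadic_radius m j `^ (- s)) ^+ 2.
have v0 : 0 < v by rewrite mulr_gt0// exprn_gt0// mulr_gt0// powR_gt0.
have Ev : ('E_P[fun w => ((X (dyadic_point t0 m (j + 1)) \- X (dyadic_point t0 m j))%R w ^+ 2)%R] <= v%:E)%E.
  rewrite [X in (X <= _)%E](EV _ _ (inr _ b1) (inr _ b0)) lee_fin.
  apply: (le_trans (VC (dyadic_radius m j) _ _ _ b1 b0)); first by rewrite rad0.
  rewrite ler_wpM2l ?(ltW C0)// lerXn2r ?nnegrE ?mulr_ge0 ?powR_ge0//.
  rewrite ler_wpM2r ?powR_ge0// ge0_ler_powR ?nnegrE ?(ltW m2V)// ltW//.
  exact: lt_trans sg1.
apply: (le_trans (gaussian_limit_tail P _ _ _ (gaussX _ _ b1.1 b0.1) v0 Ev thr0)).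
rewrite lee_fin ler_pM2l// ler_expR lerN2 le_eqVlt; apply/orP; left; apply/eqP.
have qE : q ^+ m = (2 ^- m) `^ sigma.
  rewrite /q -(powR_mulrn m (powR_ge0 _ _)) -(powR_invn m (ler0n R 2)) -!powRrM.
  by congr (_ `^ _); ring.
have QE : Q ^+ m * ((2 ^- m) `^ sigma1) ^+ 2 = (q ^+ m) ^+ 2.
  rewrite qE /Q -(powR_mulrn m (powR_ge0 _ _)) -(powR_invn m (ler0n R 2)).
  rewrite -!(powR_mulrn 2 (powR_ge0 _ _)) -!powRrM -powRD ?pnatr_eq0 ?implybT//.
  by congr (_ `^ _); ring.
rewrite /thr /v exprMn -QE.
have sp : (2 ^- m) `^ sigma1 != 0 by rewrite gt_eqF// powR_gt0.
have rp : dyadic_radius m j `^ (- s) != 0 by rewrite gt_eqF// powR_gt0.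
have k0 : 2048 != 0 :> R by rewrite pnatr_eq0.
move: 2048 k0 (_ `^ sigma1) (dyadic_radius m j `^ (- s)) (Q ^+ m) sp rp => k k0 a b c a0 b0'.
by field; rewrite a0 b0' k0 gt_eqF.
Qed.

(** The shift makes the indices run from - 2^m to 3 * 2^m - 1, which includes every j with |j| <=
    2^m. *)
Definition bad_level (m : nat) : set T :=
  \big[setU/set0]_(i < 2 ^ m.+2) bad_increment m (Posz i - (2 ^ m)%N%:Z).

Lemma bad_level_limsup : P (lim_sup_set bad_level) = 0%E.
Proof.
apply: lim_sup_set_cvg0.
  by move=> m; apply: bigsetU_measurable => i _; exact: measurable_bad_increment.
have k0 : 0 < 2048 :> R by rewrite ltr0n.
have c0 : 0 < (2048 * C)^-1 by rewrite invr_gt0 (mulr_gt0 k0 C0).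
have Q1 : 1 < Q.
  have p0 : 0 < 2 * (sigma1 - sigma) by rewrite mulr_gt0// subr_gt0.
  suff : 1 `^ (2 * (sigma1 - sigma)) < Q by rewrite powR1.
  by apply: gt0_ltr_powR => //; rewrite ?nnegrE ?ler0n ?ltr1n.
have [K K0 KQ] := exp_geometric _ _ c0 Q1.
(* There are 4 * 2^m increments, each bad with probability at most 2 K / 4^m, for a total of 8 K /
   2^m; it is written over 2^(m + 1) to match the half-geometric series. *)
have Pm m : (P (bad_level m) <= (16 * K / (2 ^ (m + 1))%:R)%:E)%E.
  have expK : expR (- ((2048 * C)^-1 * Q ^+ m)) <= K / 4 ^+ m.
    by rewrite ler_pdivlMr ?exprn_gt0// mulrC.
  rewrite /bad_level.
  have := Boole_inequality P (A := fun i => bad_increment m (Posz i - (2 ^ m)%N%:Z))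
    (n := 2 ^ m.+2) (fun i _ => measurable_bad_increment m _).
  move=> /le_trans; apply.
  apply: (@le_trans _ _ (\sum_(i < 2 ^ m.+2) (2 * (K / 4 ^+ m))%:E)%E).
    apply: lee_sum => i _; apply: (le_trans (bad_increment_le _ _)).
    by rewrite lee_fin ler_pM2l.
  rewrite sumEFin lee_fin sumr_const card_ord le_eqVlt; apply/orP; left; apply/eqP.
  rewrite -[LHS]mulr_natr !natrX addn1 !exprS (_ : 4 = 2 * 2 :> R); last by ring.
  have m20 : 2 ^+ m != 0 :> R by rewrite expf_neq0.
  rewrite exprMn; move: (2 ^+ m) m20 => y y0.
  by field.
apply: (@le_lt_trans _ _ (16 * K)%:E); last exact: ltry.
have sumE : (\sum_(0 <= m <oo) (16 * K / (2 ^ (m + 1))%:R)%:E = (16 * K)%:E)%E.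
  apply/cvg_lim => //; rewrite -[X in _ --> X%:E]divr1 -[X in _ / X](expr0 2).
  exact: cvg_geometric_eseries_half.
rewrite -sumE; apply: lee_nneseries => // m _; exact: Pm.
Qed.

Lemma variance_microlocal_ae :
  {ae P, forall w, {within `[0, +oo[, continuous (fun t => X t w)}} ->
  {ae P, forall w, microlocal (fun t => X t w) t0 s sigma}.
Proof.
move=> contX.
have goodP : {ae P, forall w, ~ lim_sup_set bad_level w}.
  exists (lim_sup_set bad_level); split.
  - apply: bigcap_measurable => // i _; apply: bigcup_measurable => l _.
    by apply: bigsetU_measurable => ? _; exact: measurable_bad_increment.
  - exact: bad_level_limsup.
  - by move=> w /= /contrapT.
(* Outside the upper limit there is a level [m0] from which on no increment is bad. *)
move: contX goodP; apply: filterS2 => w cX /existsNP[m0 /not_implyP[_ nbad]].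
apply: (dyadic_increments_microlocal _ _ _ _ _ m0 s0 sg0 r0 cX).
move=> m j m0m jm radr; rewrite leNgt; apply/negP => big; apply: nbad.
exists m => //; rewrite /bad_level -(bigcup_mkord _ (fun i => bad_increment m (Posz i - (2 ^ m)%N%:Z))).
have jm' : `|j| <= (2 ^ m)%N%:Z.
  by rewrite -(ler_int R) intr_norm -pmulrn natrX.
have m20 : (0 < 2 ^ m)%N by rewrite expn_gt0.
exists (absz (j + (2 ^ m)%N%:Z)) => /=; first by rewrite !expnS; lia.
rewrite (_ : (absz (j + (2 ^ m)%N%:Z))%:Z - (2 ^ m)%N%:Z = j); last by lia.
by rewrite /bad_increment radr /= ltW.
Qed.

End LowerBound.

(** * Comparison of the frontiers *)

(** Indices are coded by natural numbers; a number that codes nothing gets the condition [True]. *)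
Lemma ae_forall_count {d : measure_display} {T : measurableType d} {R : realType}
    (mu : {measure set T -> \bar R}) (I : countType) (Q : I -> T -> Prop) :
  (forall i, {ae mu, forall w, Q i w}) -> {ae mu, forall w, forall i, Q i w}.
Proof.
move=> aeQ.
have : {ae mu, forall w, forall n, if unpickle n is Some i then Q i w else True}.
  by apply: ae_foralln => n; case: (unpickle n) => [i|]; [exact: aeQ|exact: aeW].
by apply: filterS => w Qw i; have := Qw (pickle i); rewrite pickleK.
Qed.

(** * From rational pairs to the whole frontier *)

Section RationalReduction.
Context {R : realType}.
Variables (f g : R -> R) (t0 h : R).
Hypothesis upper : forall q tau : rat, microlocal f t0 (ratr q) (ratr tau) ->
  microlocal g t0 (ratr q) (ratr tau) /\ ratr tau <= h + ratr q.
Hypothesis lower : forall q tau tau1 : rat, (ratr q : R) < 0 -> (0 : R) < ratr tau ->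
  (ratr tau : R) < ratr tau1 -> ratr tau1 < h + ratr q ->
  microlocal g t0 (ratr q) (ratr tau1) -> microlocal f t0 (ratr q) (ratr tau).

Lemma frontier_upper (s : R) :
  (microlocal_frontier f t0 s <= Order.min (h + s)%:E (microlocal_frontier g t0 s))%E.
Proof.
apply: ub_ereal_sup => _ [sigma /microlocalP fs <-].
suff below tau : tau < sigma -> microlocal g t0 s tau /\ tau <= h + s.
  rewrite le_min; apply/andP; split.
    rewrite lee_fin; apply/ler_addgt0Pr => e e0.
    by have [|_] := below (sigma - e); lra.
  apply/lee_subgt0Pr => e e0; rewrite -EFinB; apply: frontier_ge.
  by have [|] := below (sigma - e); first lra.
(* The first coordinate may move right by less than [ratr p - tau]: returning to [s] then costs less
   than the loss from [ratr p] to [tau], by the Lipschitz property. *)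
move=> ts; have [p] := rat_in_itvoo ts; rewrite in_itv /= => /andP[tp ps].
have [q] : exists q : rat, ratr q \in `]s, (s + (ratr p - tau))[ by apply: rat_in_itvoo; lra.
rewrite in_itv /= => /andP[sq qs].
have [] := upper q p; first by apply: (microlocal_le _ _ _ _ _ _ fs); lra.
by move=> gq ?; split; [apply: (microlocal_le _ _ _ _ _ _ gq); lra|lra].
Qed.

Lemma frontier_lower (s tau : R) : s < 0 -> 0 < tau ->
  (tau%:E < Order.min (h + s)%:E (microlocal_frontier g t0 s))%E ->
  microlocal f t0 s tau.
Proof.
move=> s0 tau0; rewrite lt_min lte_fin => /andP[th /frontier_gt[sg tsg gs]].
have m0 : 0 < Num.min sg (h + s) - tau by rewrite subr_gt0 lt_min tsg.
have mh : Num.min sg (h + s) <= h + s by rewrite ge_min lexx orbT.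
have msg : Num.min sg (h + s) <= sg by rewrite ge_min lexx.
move: (Num.min sg (h + s)) => m in m0 mh msg *.
(* Two rational exponents are needed because [lower] loses order from [ratr p1] to [ratr p]. Taking
   [ratr q] to the left of [s] keeps it negative, and the margin [m - ratr p1] bounds the
   displacement. *)
have [p1] : exists p : rat, ratr p \in `]tau, m[ by apply: rat_in_itvoo; lra.
rewrite in_itv /= => /andP[tp1 p1m].
have [p] : exists p : rat, ratr p \in `]tau, (ratr p1 : R)[ by apply: rat_in_itvoo.
rewrite in_itv /= => /andP[tp pp1].
have [q] : exists q : rat, ratr q \in `](s - (m - ratr p1)), s[ by apply: rat_in_itvoo; lra.
rewrite in_itv /= => /andP[sq qs].
have fq : microlocal f t0 (ratr q) (ratr p).
  apply: (lower q p p1) => //; [lra|lra|lra|].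
  by apply: (microlocal_le _ _ _ _ _ _ gs); lra.
by apply: (microlocal_le _ _ _ _ _ _ fq); lra.
Qed.

(** If the two values differed at a point of either graph, a positive level would fit strictly
    between them, since sigma > 0 in the region; [frontier_lower] at that level gives a
    contradiction. *)
Lemma frontier_graph : graph_in region_D (microlocal_frontier f t0) =
  graph_in region_D (fun s => Order.min (h + s)%:E (microlocal_frontier g t0 s)).
Proof.
apply/seteqP; split => -[s sigma] [Dp /= fs]; split => //=;
  have [/andP[_ /= s0] /andP[/= sg0 _]] := Dp; apply/eqP; rewrite eq_le.
- rewrite -[X in (_ <= X)%O && _]fs -[X in _ && (X <= _)%O]fs frontier_upper andbT.
  rewrite leNgt; apply/negP; rewrite fs => sm.
  have [tau st tm] : exists2 tau : R, sigma < tau &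
      (tau%:E < Order.min (h + s)%:E (microlocal_frontier g t0 s))%E.
    move: (Order.min _ _) sm => [m||//]; last by exists (sigma + 1); [lra|rewrite ltry].
    by rewrite lte_fin => sm; exists ((sigma + m) / 2); [lra|rewrite lte_fin; lra].
  have := frontier_ge _ _ _ _ (frontier_lower s tau s0 (lt_trans sg0 st) tm).
  by rewrite fs lee_fin leNgt st.
- rewrite -fs frontier_upper /= fs leNgt; apply/negP => fsg.
  have [tau /andP[tau0 ts] ft] : exists2 tau : R, 0 < tau < sigma &
      (microlocal_frontier f t0 s < tau%:E)%E.
    move: (microlocal_frontier f t0 s) fsg => [m|//|_]; last first.
      by exists (sigma / 2); [apply/andP; split; lra|rewrite ltNyr].
    rewrite lte_fin => ms; have : Num.max m 0 < sigma by rewrite gt_max ms.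
    have m1 : m <= Num.max m 0 by rewrite le_max lexx.
    have m2 : 0 <= Num.max m 0 by rewrite le_max lexx orbT.
    move: (Num.max m 0) m1 m2 => y my y0 ys.
    by exists ((y + sigma) / 2); [apply/andP; split; lra|rewrite lte_fin; lra].
  have tm : (tau%:E < Order.min (h + s)%:E (microlocal_frontier g t0 s))%E.
    by rewrite fs lte_fin.
  by have := frontier_ge _ _ _ _ (frontier_lower s tau s0 tau0 tm); rewrite leNgt ft.
Qed.

End RationalReduction.

Theorem proposition4p3 (R : realType) (d : measure_display)
    (T : measurableType d) (P : probability T R)
    (H : R -> R) (X : R -> {RV P >-> R})
    (H01 : forall t : R, 0 <= t -> 0 < H t < 1)
    (mbmX : mbm H X)
    (contX : {ae P, forall w, {within `[0, +oo[, continuous (fun t => X t w)}})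
    (t0 : R) (t0_ge0 : 0 <= t0)
    (varX : increment_variance H X t0) :
  {ae P, forall w,
    graph_in region_D (microlocal_frontier (fun t => X t w) t0) =
    graph_in region_D (fun s' =>
      Order.min (H t0 + s')%:E (microlocal_frontier H t0 s'))}.
Proof.
have gaussX t u : 0 <= t -> 0 <= u -> gaussian_limit P (X t \- X u)%R.
  exact: mbm_increment_gaussian mbmX.
have [V [k [C [r [k0 C0 r0 VP]]]]] := increment_variance_bounds P H X t0 varX.
have upper : {ae P, forall w (p : rat * rat),
    microlocal (fun t => X t w) t0 (ratr p.1) (ratr p.2) ->
    microlocal H t0 (ratr p.1) (ratr p.2) /\ ratr p.2 <= H t0 + ratr p.1}.
  apply: ae_forall_count => -[q tau] /=.
  (* The condition on [H] is deterministic: either it holds and the implication is trivial, or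
     almost no path is regular of this order. *)
  have [Hq|nHq] := pselect (microlocal H t0 (ratr q) (ratr tau) /\ (ratr tau : R) <= H t0 + ratr q).
    exact: aeW.
  by have := not_microlocal_ae P H X t0 t0_ge0 V k C r k0 r0 VP gaussX _ _ nHq; apply: filterS.
have lower : {ae P, forall w (p : rat * rat * rat),
    (ratr p.1.1 : R) < 0 -> (0 : R) < ratr p.1.2 -> (ratr p.1.2 : R) < ratr p.2 ->
    ratr p.2 < H t0 + ratr p.1.1 -> microlocal H t0 (ratr p.1.1) (ratr p.2) ->
    microlocal (fun t => X t w) t0 (ratr p.1.1) (ratr p.1.2)}.
  apply: ae_forall_count => -[[q tau] tau1] /=.
  have [q0|] := boolP ((ratr q : R) < 0); last by move=> ?; apply: aeW.
  have [tau0|] := boolP ((0 : R) < ratr tau); last by move=> ?; apply: aeW.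
  have [tt1|] := boolP ((ratr tau : R) < ratr tau1); last by move=> ?; apply: aeW.
  have [t1H|] := boolP ((ratr tau1 : R) < H t0 + ratr q); last by move=> ?; apply: aeW.
  have [Hq|] := pselect (microlocal H t0 (ratr q) (ratr tau1)); last by move=> ?; apply: aeW.
  have [C' [r' [C'0 r'0 rr VC]]] := microlocal_to_variance P H X t0 t0_ge0 V k C r C0 r0 VP
    _ _ q0 (lt_trans tau0 tt1) t1H Hq.
  have EV t u : Rplus_ball t0 r' t -> Rplus_ball t0 r' u ->
      ('E_P[fun w => ((X t w - X u w) ^+ 2)%R] = (V t u)%:E)%E.
    move=> [t0' tr] [u0' ur]; have [] // := VP t u.
      by split => //; exact: lt_le_trans rr.
    by split => //; exact: lt_le_trans rr.
  have := variance_microlocal_ae P X V t0 _ _ _ C' r' t0_ge0 q0 tau0 tt1 C'0 r'0 gaussX EV VC contX.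
  by apply: filterS.
move: upper lower; apply: filterS2 => w up lo; apply: frontier_graph => [q tau|q tau tau1].
  exact: (up (q, tau)).
exact: (lo (q, tau, tau1)).
Qed.
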